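(* Let $m$ be an integer with $1\le m\le 5$, let $a,b\in\mathbb{Z}$ be such that $x^6+ax^m+b$ is irreducible over $\mathbb{Q}$, and let $K=\mathbb{Q}(\theta)$ be the sextic number field generated by a complex root $\theta$ of $x^6+ax^m+b$. Then the following hold: (1) If $a\equiv 0\pmod 9$ and $b\equiv -1\pmod 9$, then $i(K)\equiv 3$ or $6\pmod 9$. (2) If $a\equiv 0\pmod 8$ and $b\equiv -1\pmod 8$, then $i(K)\equiv 4\pmod 8$. In particular, if one of these two pairs of congruence conditions on $(a,b)$ holds, then $K$ is not monogenic.
   Context: A number field $K$ with ring of integers $\mathbb{Z}_K$ is called monogenic if there is $\eta\in\mathbb{Z}_K$ with $\mathbb{Z}_K=\mathbb{Z}[\eta]$. The index of the field $K$ is $i(K)=\gcd\{(\mathbb{Z}_K:\mathbb{Z}[\eta]) \mid \eta\in\mathbb{Z}_K,\ K=\mathbb{Q}(\eta)\}$, where $(\mathbb{Z}_K:\mathbb{Z}[\eta])$ is the (finite) index of the subgroup $\mathbb{Z}[\eta]$ in $\mathbb{Z}_K$. *)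

(* Defs.v *)
From HB Require Import structures.
From mathcomp Require Import all_boot all_order all_algebra all_field.
From mathcomp Require Import finmap.
From mathcomp Require Import all_classical.
Set Implicit Arguments.
Unset Strict Implicit.
Unset Printing Implicit Defensive.
Import GRing.Theory.
Local Open Scope classical_set_scope.
Local Open Scope ring_scope.

(* Greatest common divisor of a possibly infinite set of natural numbers: the
   common divisor that every common divisor divides (see set_gcdP). *)
Definition is_set_gcd (S : set nat) (d : nat) : Prop :=
  (forall n, S n -> (d %| n)%N) /\
  (forall e, (forall n, S n -> (e %| n)%N) -> (e %| d)%N).

Definition set_gcd (S : set nat) : nat := xget 0%N [set d | is_set_gcd S d].

Lemma set_gcdP (S : set nat) : is_set_gcd S (set_gcd S).
Proof.
apply: (@xgetPex _ 0%N [set d | is_set_gcd S d]).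
have [[n [Sn n_gt0]]|noS] := pselect (exists n, S n /\ (0 < n)%N); last first.
  exists 0%N; split=> // n Sn; rewrite dvd0n; apply/negPn/negP => n0.
  by apply: noS; exists n; rewrite lt0n.
pose P e := `[< forall n, S n -> (e %| n)%N >].
exists (\big[lcmn/1%N]_(e < n.+1 | P e) (e : nat)); split=> [k Sk|e eS].
  apply: (big_ind (fun d => (d %| k)%N)) => [|x y xk yk|e /asboolP/(_ k Sk)//].
    exact: dvd1n.
  by rewrite dvdn_lcm xk.
have e_le : (e < n.+1)%N by rewrite ltnS dvdn_leq ?eS.
have Pe : P (Ordinal e_le) by apply/asboolP.
by rewrite (bigD1 (Ordinal e_le)) //= dvdn_lcml.
Qed.

(* (G : H) as the number of cosets x + H with x in G; it is 0 when there are
   infinitely many cosets, because fset_set sends infinite sets to fset0. *)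
Definition subgroup_index (V : zmodType) (G H : set V) : nat :=
  #|` fset_set [set [set y | H (y - x)] | x in G] |%fset.

Section NumberField.
Variable K : fieldExtType rat.

Definition ring_of_integers : set K :=
  [set x | integralOver (intr : int -> K) x].

Definition Zadjoin (eta : K) : set K :=
  [set (map_poly (intr : int -> K) p).[eta] | p in [set: {poly int}]].

Definition monogenic : Prop :=
  exists2 eta, ring_of_integers eta & ring_of_integers = Zadjoin eta.

Definition field_index : nat :=
  set_gcd [set subgroup_index ring_of_integers (Zadjoin eta) |
            eta in [set eta | ring_of_integers eta /\ <<1; eta>>%VS = fullv]].

End NumberField.

Definition sextic_trinomial (m : nat) (a b : int) : {poly rat} :=
  'X^6 + a%:~R *: 'X^m + (b%:~R)%:P.

(* Main.v *)
(* Write [A] for the ring of integers and [theta ^+ 6 = 1 - p ^ 2 g] (with [8]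
   for [p = 2]).  Adjoining one explicit integer [omega] to [Z[theta]] gives an
   order [O] that is maximal at [p]: for [p = 2], [y ^+ 4 = y] in [O / 2O], so
   [O / 2O] is reduced; for [p = 3], [O / 3O] has nilradical generated by
   [delta = theta ^+ 2 - 1], with [delta ^+ 2 = 3 omega].  Hence
   [A / pA = O / pO] has order [p ^ 6].  Its elements all satisfy a monic
   equation of degree 4 for [p = 2] and 5 for [p = 3], because it has more
   residue fields of some degree than there are polynomials to tell them apart;
   so [p ^ k] divides every index [(A : Z[eta])], with [k = 2], resp. [k = 1].  Conversely, if
   [A = Z[eta] + <u_1, ..., u_k> + pA] with all [p u_i] in [Z[eta]], then by
   Nakayama [p ^ k.+1] does not divide the index, and such an [eta] is
   exhibited. *)
From HB Require Import structures.
Require Import Defs.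
From mathcomp Require Import all_boot all_order all_algebra all_field.
From mathcomp Require Import finmap all_classical zify ring.
Set Implicit Arguments.
Unset Strict Implicit.
Unset Printing Implicit Defensive.
Import Order.TTheory GRing.Theory Num.Theory.
Local Open Scope classical_set_scope.
Local Open Scope ring_scope.

(** * Indices of subgroups *)

Section SubgroupIndex.
Variable V : zmodType.
Implicit Types (G H K : set V) (T : finType).

(** The degrees 4 and 5 come from the splitting of [p]. At 2 the residue fields are F_2, F_2, F_4,
    F_4, but F_2 has only one irreducible quadratic, so [X^4 - X] already vanishes on all residues.
    At 3 there are four residue fields F_3, two of them ramified; [X^3 - X] leaves only the
    nilpotent part, and one linear factor for each ramified point removes it. The missing degrees,
    [6 - 4] and [6 - 5], are the exponents of [p]. No prime ideals and no Z-basis of [A] are used: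
    reducedness is read off from an identity [y ^+ q = y], and every index is obtained by counting
    residues. The price is that finiteness has to be earned. Lower bounds must allow for an [eta]
    that does not generate [K], and upper bounds must first prove that the exhibited [eta]
    generates. *)

Definition subgroup G := G 0 /\ forall x y, G x -> G y -> G (x - y).

Definition coset H x := [set y | H (y - x)].

Definition finite_index G H := finite_set [set coset H x | x in G].

Definition covering G H T (r : T -> V) :=
  forall x, G x -> exists t, H (x - r t).

Definition transversal G H T (r : T -> V) :=
  [/\ forall t, G (r t), covering G H r & forall s t, H (r s - r t) -> s = t].

Lemma subgroup0 G : subgroup G -> G 0. Proof. by case. Qed.

Lemma subgroupB G x y : subgroup G -> G x -> G y -> G (x - y).
Proof. by move=> [_ GB]; exact: GB. Qed.

Lemma subgroupN G x : subgroup G -> G x -> G (- x).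
Proof. by move=> [G0 GB] Gx; rewrite -sub0r; exact: GB. Qed.

Lemma subgroupD G x y : subgroup G -> G x -> G y -> G (x + y).
Proof.
move=> sG Gx Gy; rewrite -(opprK y).
by apply: subgroupB => //; apply: subgroupN.
Qed.

Lemma subgroupMn G x n : subgroup G -> G x -> G (x *+ n).
Proof.
move=> sG Gx; elim: n => [|n IHn]; first by rewrite mulr0n; apply: subgroup0.
by rewrite mulrS; apply: subgroupD.
Qed.

Lemma subgroup_sub_sym H x y : subgroup H -> H (x - y) -> H (y - x).
Proof. by move=> sH Hxy; rewrite -opprB; apply: subgroupN. Qed.

Lemma subgroup_sub_trans H y x z :
  subgroup H -> H (x - y) -> H (y - z) -> H (x - z).
Proof.
by move=> sH Hxy Hyz; rewrite -[x](subrK y) -addrA; apply: subgroupD.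
Qed.

Lemma coset_eqP H x y : subgroup H -> coset H x = coset H y <-> H (x - y).
Proof.
move=> sH; split=> [eqxy|Hxy].
  have : coset H x x by rewrite /coset/= subrr; apply: subgroup0.
  by rewrite eqxy.
apply/seteqP; split=> z /= Hz; apply: (subgroup_sub_trans sH Hz) => //.
exact: subgroup_sub_sym.
Qed.

Lemma covering_finite G H T (r : T -> V) :
  subgroup H -> covering G H r ->
  finite_index G H /\ (subgroup_index G H <= #|T|)%N.
Proof.
move=> sH cGH.
have sub : [set coset H x | x in G] `<=` [set coset H (r t) | t in [set: T]].
  move=> _ /= [x Gx <-]; have [t Ht] := cGH x Gx.
  by exists t => //; apply/coset_eqP => //; apply: subgroup_sub_sym.
have fin : finite_set [set coset H (r t) | t in [set: T]].
  exact/finite_image/finite_finset.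
have finG : finite_index G H := sub_finite_set sub fin.
split=> //; rewrite /subgroup_index.
have /fsubset_leq_card le_img : (fset_set [set coset H x | x in G] `<=`
    [fset coset H (r t) | t in T])%fset.
  apply/fsubsetP => X; rewrite in_fset_set// inE => /sub[t _ <-].
  by apply/imfsetP; exists t.
by rewrite (leq_trans le_img)// (leq_trans (leq_imfset_card _ _ _))//= cardE.
Qed.

Lemma transversal_index G H T (r : T -> V) :
  subgroup H -> transversal G H r ->
  finite_index G H /\ subgroup_index G H = #|T|.
Proof.
move=> sH [Gr cGH injr]; have [finG _] := covering_finite sH cGH; split=> //.
have injc : injective (fun t => coset H (r t)).
  by move=> s t /(coset_eqP _ _ sH)/injr.
rewrite /subgroup_index.
have -> : fset_set [set coset H x | x in G] = [fset coset H (r t) | t in T]%fset.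
  apply/fsetP => X; rewrite in_fset_set//; apply/idP/imfsetP.
    rewrite inE => -[x Gx <-]; have [t Ht] := cGH x Gx.
    by exists t => //; apply/coset_eqP.
  by move=> [t _ ->]; rewrite inE; exists (r t).
by rewrite card_imfset//= cardE.
Qed.

Lemma finite_index_transversal G H : subgroup H -> finite_index G H ->
  exists (T : finType) (r : T -> V), transversal G H r.
Proof.
move=> sH finG; pose S := fset_set [set coset H x | x in G].
have rP (X : S) : exists x, G x /\ coset H x = val X.
  by have := valP X; rewrite in_fset_set// inE => -[x Gx <-]; exists x.
have [r rE] := choice rP; exists S, r; split=> [X|x Gx|X Y].
- by have [] := rE X.
- have xS : coset H x \in S by rewrite in_fset_set// inE; exists x.
  by exists [` xS]%fset; apply/coset_eqP => //; rewrite (rE [` xS]%fset).2.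
- move=> /(coset_eqP _ _ sH); rewrite (rE X).2 (rE Y).2; exact: val_inj.
Qed.

Lemma subgroup_index_gt0 G H :
  subgroup G -> subgroup H -> finite_index G H -> (0 < subgroup_index G H)%N.
Proof.
move=> sG sH finG; have [T [r trT]] := finite_index_transversal sH finG.
have [_ ->] := transversal_index sH trT.
have [_ cT _] := trT; have [t _] := cT 0 (subgroup0 sG).
by apply/card_gt0P; exists t.
Qed.

Lemma index_tower G H K : subgroup G -> subgroup H -> subgroup K ->
  H `<=` G -> K `<=` H -> finite_index G H -> finite_index H K ->
  finite_index G K /\
  subgroup_index G K = (subgroup_index G H * subgroup_index H K)%N.
Proof.
move=> sG sH sK HG KH finGH finHK.
have [T [r trT]] := finite_index_transversal sH finGH.
have [S [q trS]] := finite_index_transversal sK finHK.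
have [_ ->] := transversal_index sH trT; have [_ ->] := transversal_index sK trS.
rewrite -card_prod; move: trT trS => [Gr cT injr] [Hq cS injq].
apply: (@transversal_index _ _ _ (fun ts => r ts.1 + q ts.2)) => //; split.
- by move=> ts; apply: subgroupD => //; apply/HG.
- move=> x Gx; have [t Ht] := cT x Gx; have [s Ks] := cS _ Ht.
  by exists (t, s); rewrite /= opprD addrA.
- move=> [t s] [t' s'] /= Kts.
  have rts : t = t'.
    apply: injr; have := subgroupB sH (KH _ Kts) (subgroupB sH (Hq s) (Hq s')).
    by rewrite opprD addrACA addrK.
  by move: Kts; rewrite rts opprD addrACA subrr add0r => /injq ->.
Qed.

Lemma finite_index_sub G H K : subgroup H -> subgroup K ->
  H `<=` G -> K `<=` H -> finite_index G K ->
  finite_index G H /\ finite_index H K.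
Proof.
move=> sH sK HG KH finGK; split.
  have [T [r [Gr cT _]]] := finite_index_transversal sK finGK.
  apply: (covering_finite sH (r := r) _).1 => x /cT[t] /KH.
  by exists t.
by apply: sub_finite_set finGK => _ [x Hx <-]; exists x => //; apply: HG.
Qed.

Lemma index_dvdn G H K : subgroup G -> subgroup H -> subgroup K ->
  H `<=` G -> K `<=` H -> finite_index G K ->
  (subgroup_index G H %| subgroup_index G K)%N.
Proof.
move=> sG sH sK HG KH finGK.
have [finGH finHK] := finite_index_sub sH sK HG KH finGK.
have [_ ->] := index_tower sG sH sK HG KH finGH finHK.
exact: dvdn_mulr.
Qed.

Definition multiples n G := [set x *+ n | x in G].

Lemma subgroup_multiples n G : subgroup G -> subgroup (multiples n G).
Proof.
move=> sG; split; first by exists 0; rewrite ?mul0rn//; apply: subgroup0.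
by move=> _ _ [x Gx <-] [y Gy <-]; exists (x - y);
  [apply: subgroupB | rewrite mulrnBl].
Qed.

Lemma multiples_sub n G : subgroup G -> multiples n G `<=` G.
Proof. by move=> sG _ [x Gx <-]; apply: subgroupMn. Qed.

Lemma multiplesS n G H : G `<=` H -> multiples n G `<=` multiples n H.
Proof. by move=> GH _ [x /GH Hx <-]; exists x. Qed.

Section Scaling.
Variable n : nat.
Hypothesis injn : injective (fun x : V => x *+ n).

Lemma index_multiples G H : subgroup H -> finite_index G H ->
  finite_index (multiples n G) (multiples n H) /\
  subgroup_index (multiples n G) (multiples n H) = subgroup_index G H.
Proof.
move=> sH finGH; have [T [r trT]] := finite_index_transversal sH finGH.
have [_ ->] := transversal_index sH trT; case: trT => Gr cT injr.
apply: (@transversal_index _ _ _ (fun t => r t *+ n)).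
  exact: subgroup_multiples.
split=> [t|_ [x Gx <-]|s t [y Hy]]; first by exists (r t).
  have [t Ht] := cT x Gx; exists t; exists (x - r t) => //.
  by rewrite mulrnBl.
by rewrite -mulrnBl => /injn yE; apply: injr; rewrite -yE.
Qed.

Lemma finite_index_multiplesV G H : subgroup H ->
  finite_index (multiples n G) (multiples n H) -> finite_index G H.
Proof.
move=> sH finGH; have smH := subgroup_multiples n sH.
have [T [r trT]] := finite_index_transversal smH finGH.
case: trT => Gr cT _.
have qP t : exists x, r t = x *+ n by have [x _ <-] := Gr t; exists x.
have [q qE] := choice qP.
apply: (covering_finite sH (r := q) _).1 => x Gx.
have [|t [y Hy]] := cT (x *+ n); first by exists x.
by rewrite qE -mulrnBl => /injn yE; exists t; rewrite -yE.
Qed.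

End Scaling.

End SubgroupIndex.

(** * The ring of integers has bounded denominators *)

(** An algebraic integer divides its norm: writing its minimal polynomial as [P = c + 'X * r] gives
    [D * r.[D] = - c]. The constant [c] is nonzero, for otherwise the quotient by ['X] would be a
    smaller polynomial killing [D]. *)
Lemma Aint_dvd_nat (D : algC) : D \in Aint -> D != 0 ->
  exists (N : nat) (w : algC), [/\ (0 < N)%N, w \in Aint & D * w = N%:R].
Proof.
move=> AD D0; pose P := minCpoly D.
have PI : P \is a polyOver Num.int by [].
have [q [Pq mq] qdvd] := minCpolyP D.
have q00 : q`_0 != 0.
  apply/eqP => q00.
  have : 'X %| q by rewrite -['X]subr0 dvdp_XsubCl /root horner_coef0 q00.
  case/dvdpP => r qr; have : root (map_poly ratr r) D.
    have : root (map_poly ratr q) D by rewrite qdvd.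
    by rewrite qr rmorphM /= map_polyX rootM rootX (negbTE D0) orbF.
  rewrite qdvd => /dvdp_leq/=.
  have r0 : r != 0 by apply: contra_eq_neq qr => ->; rewrite mul0r monic_neq0.
  by rewrite r0 qr size_mulX// ltnn => /(_ isT).
have /intrP[z zE] : P`_0 \in Num.int by apply/polyOverP.
pose r := \poly_(i < (size P).-1) P`_i.+1.
have Pr : P = (P`_0)%:P + 'X * r.
  apply/polyP => -[|i]; rewrite !(coefE, coefXM) ?mul1r ?addr0//= add0r.
  case: ltnP => // h; rewrite nth_default//; move: h.
  by have := size_minCpoly D; rewrite -/P; lia.
have rA : r.[D] \in Aint.
  rewrite horner_poly rpred_sum// => i _; rewrite rpredM ?rpredX//.
  by apply: Aint_Cint; apply/polyOverP.
have DrE : D * r.[D] = - (z%:~R).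
  have : P.[D] = 0 by apply/rootP/root_minCpoly.
  rewrite [in P.[D]]Pr !hornerE zE => /eqP.
  by rewrite addrC addr_eq0 => /eqP.
have z0 : z != 0.
  apply: contra_neq q00 => z0; apply: (fmorph_inj (@ratr algC)).
  by rewrite rmorph0 -coef_map -Pq zE z0.
exists `|z|%N, (r.[D] * - (Num.sg z)%:~R); split; first by rewrite absz_gt0.
  by rewrite rpredM// rpredN Aint_int.
rewrite mulrA DrE mulrNN -intrM mulrC -normrEsg -abszE.
by rewrite pmulrn.
Qed.

Section Integers.
Variable K : fieldExtType rat.

(** A boolean form of the same set, so that closure under ring operations becomes available through
    [rpred] lemmas; [zadjoin] below serves the same purpose. *)
Definition algint : {pred K} := fun x => `[< ring_of_integers x >].

Lemma algintP x : reflect (ring_of_integers x) (x \in algint).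
Proof. exact: asboolP. Qed.

Fact algint_subring : subring_closed algint.
Proof.
split=> [|x y /algintP ? /algintP ?|x y /algintP ? /algintP ?]; apply/algintP.
- exact: integral1.
- exact: integral_sub.
- exact: integral_mul.
Qed.
HB.instance Definition _ := GRing.isSubringClosed.Build K algint algint_subring.

Lemma algint_root (p : {poly K}) u :
  p \is monic -> p \is a polyOver algint -> root p u -> u \in algint.
Proof.
move=> mp pA pu; apply/algintP; apply: integral_root_monic mp pu _ => v vp.
by apply/algintP; move/allP: pA; apply.
Qed.

(* Evaluate [x = sum c_i eta ^+ i] at all conjugates of [eta]: by Cramer's rule
   the [c_i] times the Vandermonde determinant are algebraic integers. *)
Lemma bounded_denominators eta :
  eta \in algint -> <<1; eta>>%VS = fullv :> {vspace K} ->
  exists N : nat, (0 < N)%N /\ forall x, x \in algint ->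
    exists2 p : {poly int}, (size p <= \dim {:K})%N &
      x *+ N = (map_poly intr p).[eta].
Proof.
move=> /algintP[Q mQ rQ] gen; pose d := adjoin_degree 1%VS eta.
have dE : \dim {:K} = d by rewrite -gen dim_Fadjoin dimv1 muln1.
rewrite dE.
have /polyOver1P[f fE] := minPolyOver 1 eta.
have szf : size f = d.+1 by rewrite -(size_map_poly (in_alg K)) -fE size_minPoly.
have mf : f \is monic by rewrite -(map_monic (in_alg K)) -fE monic_minPoly.
have fdvd (q : {poly rat}) : root (map_poly (in_alg K) q) eta -> f %| q.
  move=> rq; rewrite -(dvdp_map (in_alg K)) -fE minPoly_dvdp//.
  by apply/polyOver1P; exists q.
have sepf : separable_poly f.
  rewrite -(separable_map (in_alg K)) -fE.
  by apply: pcharf0_separable => p; rewrite pchar_lalg pchar_num.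
have [rs frs] := closed_field_poly_normal (map_poly (ratr : rat -> algC) f).
rewrite lead_coef_map (monicP mf) rmorph1 scale1r in frs.
have urs : uniq rs by rewrite -separable_prod_XsubC -frs separable_map.
have szrs : size rs = d.
  by apply/eqP; rewrite -eqSS -(size_prod_XsubC rs id) -frs size_map_poly szf.
have rootZ z (q : {poly rat}) : z \in rs -> f %| q -> root (map_poly ratr q) z.
  move=> zrs /dvdpP[r ->]; rewrite rmorphM rootM /= frs root_prod_XsubC zrs.
  by rewrite orbT.
have mapZ (L : comUnitRingType) (h : {rmorphism rat -> L}) (q : {poly int}) :
    map_poly h (map_poly intr q) = map_poly intr q.
  by rewrite -map_poly_comp; apply: eq_map_poly => z /=; rewrite rmorph_int.
have rsA z : z \in rs -> z \in Aint.
  move=> zrs; apply: (@root_monic_Aint (map_poly intr Q)).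
  - rewrite -(mapZ _ ratr); apply: rootZ => //; apply: fdvd.
    by rewrite mapZ.
  - exact: monic_map.
  - by apply/polyOverP => i; rewrite coef_map /= rpred_int.
(* Conjugates of an integer are integers: if [P] is a monic equation of [c(eta)], then [P(c)]
   vanishes at [eta], hence at every conjugate [z]. *)
have valA (c : {poly rat}) z : (map_poly (in_alg K) c).[eta] \in algint ->
    z \in rs -> (map_poly ratr c).[z] \in Aint.
  move=> /algintP[P mP rP] zrs; apply: (@root_monic_Aint (map_poly intr P)).
  - rewrite -(mapZ _ ratr) /root -horner_comp -map_comp_poly.
    apply: rootZ => //; apply: fdvd.
    by rewrite map_comp_poly /root horner_comp mapZ.
  - exact: monic_map.
  - by apply/polyOverP => i; rewrite coef_map /= rpred_int.
pose v : 'rV[algC]_d := \row_j rs`_j.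
have vA j : v 0 j \in Aint by rewrite mxE; apply/rsA/mem_nth; rewrite szrs.
pose W := Vandermonde d v.
have WA i j : W i j \in Aint by rewrite mxE rpredX.
have detA m (M : 'M[algC]_m) : (forall i j, M i j \in Aint) -> \det M \in Aint.
  move=> MA; rewrite rpred_sum// => s _; rewrite rpredM//.
    by rewrite rpredX// rpredN rpred1.
  exact: rpred_prod.
have W0 : \det W != 0.
  rewrite det_Vandermonde; apply/prodf_neq0 => i _; apply/prodf_neq0 => j ij.
  rewrite subr_eq0 !mxE nth_uniq ?szrs//.
  by rewrite eq_sym; apply: contraTneq ij => /val_inj ->; rewrite ltnn.
have adjA i j : (\adj W) i j \in Aint.
  rewrite mxE rpredM ?rpredX ?rpredN ?rpred1// detA// => k l.
  by rewrite 2!mxE; exact: WA.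
(* [\det W] need not be rational; it is traded for a positive integer multiple [N], which is the
   common denominator. *)
have [N [w [N0 wA NE]]] := Aint_dvd_nat (detA _ _ WA) W0.
exists N; split=> // x xA.
have Kx : x \in <<1; eta>>%VS by rewrite gen memvf.
have /polyOver1P[c cE] := Fadjoin_polyOver 1 eta x.
have xc : (map_poly (in_alg K) c).[eta] = x by rewrite -cE Fadjoin_poly_eq.
have szc : (size c <= d)%N.
  by rewrite -(size_map_poly (in_alg K)) -cE size_Fadjoin_poly.
pose u : 'rV[algC]_d := \row_i ratr c`_i.
have uWA j : (u *m W) 0 j \in Aint.
  have -> : (u *m W) 0 j = (map_poly ratr c).[rs`_j].
    rewrite (@horner_coef_wide _ d) ?size_map_poly// mxE.
    by apply: eq_bigr => i _; rewrite !mxE coef_map.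
  by apply: valA; rewrite ?xc//; apply: mem_nth; rewrite szrs.
have cN i : (i < d)%N -> c`_i * N%:R \is a Num.int.
  move=> id.
  have : ratr (c`_i * N%:R) \in Aint.
    have : (u *m W *m \adj W) 0 (Ordinal id) * w \in Aint.
      by rewrite rpredM// mxE rpred_sum// => j _; rewrite rpredM.
    rewrite -mulmxA mul_mx_adj mul_mx_scalar !mxE mulrAC NE /= mulrC.
    by rewrite rmorphM /= rmorph_nat.
  move=> /(Cint_rat_Aint (Crat_rat _)) /intrP[z /eqP].
  rewrite -(rmorph_int (ratr : {rmorphism rat -> algC})) => /eqP/fmorph_inj ->.
  exact: rpred_int.
(* By [cN] these products are integers already, so the floor only names them. *)
exists (\poly_(i < d) Num.floor (c`_i * N%:R)); first exact: size_poly.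
rewrite -xc (@horner_coef_wide _ d) ?size_map_poly//.
rewrite (@horner_coef_wide _ d _ _ (leq_trans (size_poly _ _) (size_poly _ _))).
rewrite -sumrMnl; apply: eq_bigr => i _; rewrite !coef_map coef_poly ltn_ord.
rewrite -mulrnAl; congr (_ * _).
have /floorK cE' := cN i (ltn_ord i).
transitivity (in_alg K (c`_i * N%:R)).
  by rewrite rmorphM rmorph_nat mulr_natr.
by rewrite -[in LHS]cE' rmorph_int.
Qed.

End Integers.

Arguments algint K : clear implicits.

(** * Indices of monogenic orders *)

Lemma infinite_index (V : zmodType) (G H : set V) :
  ~ finite_index G H -> subgroup_index G H = 0%N.
Proof.
rewrite /finite_index /subgroup_index /fset_set => infG.
by case: pselect => // _; rewrite cardfs0.
Qed.

(** Both factors are powers of [p], so an upper bound on the size of one is a divisibility statement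
    about the other. This turns counts of residues into lower bounds for indices. *)
Lemma logn_index_complement p d r i j : prime p ->
  (i * j = p ^ d)%N -> (j <= p ^ r)%N -> (p ^ (d - r) %| i)%N.
Proof.
move=> pp ijE jr; have p1 := prime_gt1 pp.
have /(dvdn_pfactor _ _ pp)[e ed jE] : (j %| p ^ d)%N by rewrite -ijE dvdn_mull.
move: jr; rewrite jE leq_exp2l// => er.
have -> : i = (p ^ (d - e))%N.
  apply/eqP; rewrite -(@eqn_pmul2r (p ^ e)) ?expn_gt0 ?prime_gt0//.
  by rewrite -jE ijE jE -expnD subnK.
by rewrite dvdn_exp2l// leq_sub2l.
Qed.

Lemma multiple_lt_eq0 (x : int) (a b n : nat) :
  (a < n)%N -> (b < n)%N -> x * n%:Z = a%:Z - b%:Z -> x = 0.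
Proof.
move=> an bn xE; have [x1|x1|//] := ltgtP x 0.
  have : x * n <= -1 * n%:Z by rewrite ler_wpM2r//; lia.
  lia.
have : 1 * n%:Z <= x * n by rewrite ler_wpM2r//; lia.
lia.
Qed.

Section Index.
Variable K : fieldExtType rat.
Local Notation A := (@ring_of_integers K).
Local Notation d := (\dim {:K}).

Lemma natr_neq0 n : (0 < n)%N -> n%:R != 0 :> K.
Proof.
by move=> n0; rewrite -(rmorph_nat (in_alg K)) fmorph_eq0 pnatr_eq0 -lt0n.
Qed.

Lemma natmul_inj n : (0 < n)%N -> injective (fun x : K => x *+ n).
Proof.
move=> n0 x y /=; rewrite -!scaler_nat => /scalerI; apply.
by rewrite pnatr_eq0 -lt0n.
Qed.

Definition zadjoin (eta : K) : {pred K} := fun x => `[< Zadjoin eta x >].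

Lemma zadjoinP eta x :
  reflect (exists p : {poly int}, x = (map_poly intr p).[eta]) (x \in zadjoin eta).
Proof.
apply: (iffP (asboolP _)) => [[p _ <-]|[p ->]]; first by exists p.
by exists p.
Qed.

Fact zadjoin_subring eta : subring_closed (zadjoin eta).
Proof.
split=> [|_ _ /zadjoinP[p ->] /zadjoinP[q ->]|_ _ /zadjoinP[p ->] /zadjoinP[q ->]].
- by apply/zadjoinP; exists 1; rewrite rmorph1 hornerC.
- by apply/zadjoinP; exists (p - q); rewrite rmorphB !hornerE.
- by apply/zadjoinP; exists (p * q); rewrite rmorphM !hornerE.
Qed.
HB.instance Definition _ eta :=
  GRing.isSubringClosed.Build K (zadjoin eta) (zadjoin_subring eta).

Lemma zadjoin_gen eta : eta \in zadjoin eta.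
Proof. by apply/zadjoinP; exists 'X; rewrite map_polyX hornerX. Qed.

Lemma horner_int_closed (S : subringClosed K) (p : {poly int}) x :
  x \in S -> (map_poly intr p).[x] \in S.
Proof.
move=> xS; rewrite rpred_horner//.
by apply/polyOverP => i; rewrite coef_map /= rpred_int.
Qed.

Lemma zadjoin_sub (S : subringClosed K) eta :
  eta \in S -> {subset zadjoin eta <= S}.
Proof. by move=> etaS _ /zadjoinP[p ->]; apply: horner_int_closed. Qed.

Lemma subgroup_zmod (S : zmodClosed K) : subgroup [set x | x \in S].
Proof. by split=> [|x y]; [apply: rpred0 | apply: rpredB]. Qed.

Lemma algintE : A = [set x | x \in algint K].
Proof. by apply/seteqP; split=> x; [move/algintP | move=> /algintP]. Qed.

Lemma ZadjoinE (eta : K) : Zadjoin eta = [set x | x \in zadjoin eta].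
Proof. by apply/seteqP; split=> x /asboolP. Qed.

Lemma subgroup_algint : subgroup A.
Proof. rewrite algintE; exact: subgroup_zmod. Qed.

Lemma subgroup_zadjoin (eta : K) : subgroup (Zadjoin eta).
Proof. rewrite ZadjoinE; exact: subgroup_zmod. Qed.

Lemma zadjoin_algint eta : eta \in algint K -> Zadjoin eta `<=` A.
Proof. by move=> etaA x; rewrite algintE ZadjoinE; apply: zadjoin_sub. Qed.

Lemma horner_int_inj (eta : K) (p : {poly int}) : <<1; eta>>%VS = fullv :> {vspace K} ->
  (size p <= d)%N -> (map_poly intr p).[eta] = 0 -> p = 0.
Proof.
move=> gen szp p0; pose P : {poly K} := map_poly intr p.
have PK : P \is a polyOver 1%VS.
  by apply/polyOverP => i; rewrite coef_map /= rpred_int.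
have := minPoly_dvdp PK (introT eqP p0).
have [->//|nz] := eqVneq p 0.
have inj_int : injective (intr : int -> K).
  move=> x y xy; apply: (@intr_inj rat); apply: (fmorph_inj (in_alg K)).
  by rewrite !rmorph_int.
have szP : size P = size p by rewrite size_map_inj_poly.
have nzP : P != 0 by rewrite -size_poly_eq0 szP size_poly_eq0.
move=> /dvdp_leq => /(_ nzP); rewrite szP size_minPoly.
have <- : d = adjoin_degree 1%VS eta by rewrite -gen dim_Fadjoin dimv1 muln1.
by move=> /leq_trans/(_ szp); rewrite ltnn.
Qed.

(** For [n = d] and [eta] a generator of [K], this is the free lattice on [1, ..., eta ^+ (d - 1)].
    Its residues modulo [n] can be listed directly, which makes it the yardstick for [A]. *)
Definition polys_below (eta : K) n : set K :=
  [set (map_poly intr p).[eta] | p in [set p : {poly int} | (size p <= n)%N]].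

Lemma subgroup_polys_below eta n : subgroup (polys_below eta n).
Proof.
split=> [|_ _ [p szp <-] [q szq <-]].
  by exists 0; rewrite /= ?size_poly0// rmorph0 horner0.
exists (p - q) => /=; last by rewrite rmorphB !hornerE.
by rewrite (leq_trans (size_polyD _ _))// geq_max szp size_polyN.
Qed.

Lemma horner_sum_ord (p : {poly int}) n eta : (size p <= n)%N ->
  (map_poly intr p).[eta] = \sum_(i < n) eta ^+ i *~ p`_i :> K.
Proof.
move=> szp; rewrite (horner_coef_wide _ (leq_trans (size_poly _ _) szp)).
by apply: eq_bigr => i _; rewrite coef_map /= mulrzl.
Qed.

Definition residue_sum n p (u : 'I_n -> K) (f : {ffun 'I_n -> 'I_p}) : K :=
  \sum_i u i *+ f i.

Lemma residue_sumP n p (u : 'I_n -> K) (c : 'I_n -> int) : (0 < p)%N ->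
  exists (f : {ffun 'I_n -> 'I_p}) (b : 'I_n -> int),
    \sum_i u i *~ c i = residue_sum u f + (\sum_i u i *~ b i) *+ p.
Proof.
move=> p0; have ltp i : (`|(c i %% p)%Z| < p)%N.
  have := ltz_pmod (c i) (p0 : 0 < p :> int).
  by have := modz_ge0 (c i) (lt0n_neq0 p0 : p != 0 :> int); lia.
exists [ffun i => Ordinal (ltp i)], (fun i => (c i %/ p)%Z).
rewrite /residue_sum -sumrMnl -big_split; apply: eq_bigr => i _ /=.
rewrite ffunE /= !pmulrn -mulrzA -mulrzDr; congr (_ *~ _).
rewrite gez0_abs ?modz_ge0 -?lt0n// {1}(divz_eq (c i) p); lia.
Qed.

Lemma index_polys_below (eta : K) n : <<1; eta>>%VS = fullv :> {vspace K} ->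
  (0 < n)%N -> let L := polys_below eta d in
  finite_index L (multiples n L) /\
  subgroup_index L (multiples n L) = (n ^ d)%N.
Proof.
move=> gen n0 /=.
rewrite -[d in (n ^ d)%N]card_ord -[n in (n ^ _)%N]card_ord -card_ffun.
have sumP (c : 'I_d -> int) : polys_below eta d (\sum_(i < d) eta ^+ i *~ c i).
  exists (\poly_(i < d) oapp c 0 (insub i)).
    exact: size_poly.
  rewrite (horner_sum_ord _ (size_poly _ _)); apply: eq_bigr => i _.
  by rewrite coef_poly ltn_ord valK.
apply: (@transversal_index _ _ _ _ (@residue_sum d n (fun i => eta ^+ i))).
  exact/subgroup_multiples/subgroup_polys_below.
split.
- move=> f; rewrite /residue_sum; under eq_bigr do rewrite pmulrn; exact: sumP.
- move=> _ [p szp <-]; rewrite (horner_sum_ord _ szp).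
  have [f [b ->]] := residue_sumP (fun i : 'I_d => eta ^+ i) (fun i => p`_i) n0.
  by exists f; rewrite addrC addKr; exists (\sum_(i < d) eta ^+ i *~ b i).
- move=> f g [_ [p szp <-]]; rewrite /residue_sum -sumrB.
  under eq_bigr do rewrite !pmulrn -mulrzBr.
  rewrite (horner_sum_ord _ szp) -sumrMnl => pE.
  (* [q] collects the coefficients of a relation between powers of [eta] below [d], so it vanishes.
     Then [f i - g i] is a multiple of [n] of absolute value less than [n]. The [oapp] extends the
     digits by 0 outside ['I_d]. *)
  pose q := \poly_(i < d)
    (p`_i * n - oapp (fun j : 'I_d => (f j)%:Z - (g j)%:Z) 0 (insub i)).
  have q0 : q = 0.
    apply: (horner_int_inj gen); first exact: size_poly.
    rewrite (horner_sum_ord _ (size_poly _ _)).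
    rewrite -[RHS](subrr (\sum_(i < d) eta ^+ i *~ p`_i *+ n)).
    rewrite {2}pE -sumrB; apply: eq_bigr => i _.
    rewrite coef_poly ltn_ord valK [LHS]mulrzBr [in RHS]pmulrn -mulrzA.
    by [].
  apply/ffunP => i; apply/val_inj; have /(congr1 (fun q : {poly int} => q`_i)) := q0.
  rewrite coef_poly ltn_ord valK coef0 /= => /eqP; rewrite subr_eq0 => /eqP pfg.
  have := ltn_ord (f i); have := ltn_ord (g i) => /= gn fn.
  have pi0 := multiple_lt_eq0 fn gn pfg.
  by move: pfg; rewrite pi0 mul0r => /esym/eqP; rewrite subr_eq0 eqz_nat => /eqP.
Qed.

(** Gauss's lemma: the rational minimal polynomial divides the monic integer polynomial [Q], so it
    is proportional to an integer divisor of [Q]. The leading coefficient of that divisor is a unit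
    of Z, hence its own inverse, and scaling by it gives a monic polynomial. *)
Lemma integral_min_poly eta : eta \in algint K ->
  exists2 q : {poly int}, q \is monic /\ size q = (\dim <<1; eta>>).+1 &
    (map_poly intr q).[eta] = 0.
Proof.
move=> /algintP[Q mQ rQ].
have /polyOver1P[f fE] := minPolyOver 1 eta.
have mapZ (q : {poly int}) :
    map_poly (in_alg K) (map_poly intr q) = map_poly intr q.
  by rewrite -map_poly_comp; apply: eq_map_poly => z; exact: rmorph_int.
have mf : f \is monic by rewrite -(map_monic (in_alg K)) -fE monic_minPoly.
have : f %| map_poly intr Q.
  rewrite -(dvdp_map (in_alg K)) -fE minPoly_dvdp ?mapZ//.
  by apply/polyOverP => i; rewrite coef_map /= rpred_int.
case/dvdpP_rat_int => q [a a0 fq] [r Qr].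
have : lead_coef q * lead_coef r = 1 by rewrite -lead_coefM -Qr; apply/monicP.
move=> qr1; have ql : `|lead_coef q|%N == 1%N.
  by rewrite -dvdz1; apply/dvdzP; exists (lead_coef r); rewrite mulrC.
have ll : lead_coef q * lead_coef q = 1 by lia.
have l0 : lead_coef q != 0 by lia.
exists (lead_coef q *: q); last first.
  have f0 : (map_poly (in_alg K) f).[eta] = 0 by rewrite -fE minPolyxx.
  rewrite map_polyZ hornerZ -mapZ; apply/eqP; rewrite mulf_eq0; apply/orP; right.
  move: f0; rewrite fq map_polyZ hornerZ => /eqP; rewrite mulf_eq0 fmorph_eq0.
  by rewrite (negbTE a0).
split; first by rewrite monicE lead_coefZ ll.
rewrite size_scale// -(size_map_inj_poly (f := intr : int -> rat))//.
  2: exact: (@intr_inj rat).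
rewrite -(size_scale _ a0) -fq -(size_map_poly (in_alg K)) -fE size_minPoly.
by rewrite dim_Fadjoin dimv1 muln1.
Qed.

Section Generator.
Variable theta : K.
Hypothesis thetaA : theta \in algint K.
Hypothesis gen : <<1; theta>>%VS = fullv :> {vspace K}.

(** No basis of [A] is needed: [N A] lies in the lattice [L], so [(A : L)] is finite, and computing
    [(A : n L)] through [L] and through [n A] gives [(A : L) (L : n L) = (A : n A) (n A : n L)].
    Since [(n A : n L) = (A : L)], these factors cancel. *)
Lemma index_algint_multiples n : (0 < n)%N ->
  finite_index A (multiples n A) /\ subgroup_index A (multiples n A) = (n ^ d)%N.
Proof.
move=> n0; set L := polys_below theta d.
have sL : subgroup L := subgroup_polys_below theta d.
have sA := subgroup_algint.
have LA : L `<=` A.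
  by move=> _ [p _ <-]; apply/algintP/horner_int_closed.
have [N [N0 den]] := bounded_denominators thetaA gen.
have NAL : multiples N A `<=` L.
  by move=> _ [x /algintP/den[p szp ->] <-]; exists p.
have [finN _] := index_polys_below gen N0.
have finAL : finite_index A L.
  apply: (finite_index_multiplesV (natmul_inj N0)) => //.
  apply: (finite_index_sub _ _ NAL (multiplesS LA) finN).2;
    exact: subgroup_multiples.
have [finLn idxLn] := index_polys_below gen n0.
have [finAnL idxAnL] := index_tower sA sL (subgroup_multiples n sL) LA
  (multiples_sub (n := n) sL) finAL finLn.
have [finAnA _] := finite_index_sub (subgroup_multiples n sA)
  (subgroup_multiples n sL) (multiples_sub (n := n) sA) (multiplesS LA) finAnL.
split=> //.
have [finnn idxnn] := index_multiples (natmul_inj n0) sL finAL.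
have [_ idxAnL'] := index_tower sA (subgroup_multiples n sA)
  (subgroup_multiples n sL) (multiples_sub (n := n) sA) (multiplesS LA) finAnA finnn.
have AL0 := subgroup_index_gt0 sA sL finAL.
apply/eqP; rewrite -(eqn_pmul2r AL0) -{1}idxnn -idxAnL' idxAnL idxLn.
by rewrite mulnC.
Qed.

Lemma index_between n C : (0 < n)%N -> subgroup C -> multiples n A `<=` C ->
  C `<=` A -> finite_index A C /\ (subgroup_index A C %| n ^ d)%N.
Proof.
move=> n0 sC nAC CA; have [fin <-] := index_algint_multiples n0.
have smA := subgroup_multiples n subgroup_algint.
split; last exact: index_dvdn subgroup_algint sC smA CA nAC fin.
exact: (finite_index_sub sC smA CA nAC fin).1.
Qed.

(** * Lower bounds for the power of p in an index *)

Definition adjoin_mod (eta : K) p : set K :=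
  [set b + a *+ p | b in Zadjoin eta & a in A].

Lemma subgroup_adjoin_mod eta p : subgroup (adjoin_mod eta p).
Proof.
split=> [|_ _ [b bB [a aA <-]] [b' b'B [a' a'A <-]]].
  exists 0; first exact: subgroup0 (subgroup_zadjoin eta).
  by exists 0; [exact: subgroup0 subgroup_algint | rewrite mul0rn addr0].
exists (b - b'); first exact: subgroupB (subgroup_zadjoin eta) _ _.
exists (a - a'); first exact: subgroupB subgroup_algint _ _.
by rewrite mulrnBl opprD addrACA.
Qed.

(** Division by [q] leaves at most [p ^ r] classes of [Z[eta] + pA] modulo [pA], out of the [p ^ d]
    classes of [A]. Adding [pA] keeps the index finite even when [eta] does not generate [K]. *)
Lemma dvdn_index_adjoin_mod p eta (q : {poly int}) r : prime p ->
  eta \in algint K -> q \is monic -> size q = r.+1 ->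
  multiples p A (map_poly intr q).[eta] ->
  finite_index A (adjoin_mod eta p) /\
  (p ^ (d - r) %| subgroup_index A (adjoin_mod eta p))%N.
Proof.
move=> pp etaA mq szq qp; have p0 := prime_gt0 pp.
have sA := subgroup_algint; have sH := subgroup_adjoin_mod eta p.
have smA := subgroup_multiples p sA.
have HA : adjoin_mod eta p `<=` A.
  move=> _ [b bB [a aA <-]]; apply: subgroupD sA _ (subgroupMn _ sA aA).
  exact: zadjoin_algint bB.
have pAH : multiples p A `<=` adjoin_mod eta p.
  move=> _ [a aA <-]; exists 0; first exact: subgroup0 (subgroup_zadjoin eta).
  by exists a; rewrite ?add0r.
have [fin idx] := index_algint_multiples p0.
have [finAH finHp] := finite_index_sub sH smA HA pAH fin.
split=> //; have [_] := index_tower sA sH smA HA pAH finAH finHp.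
rewrite idx => /esym/logn_index_complement; apply=> //.
rewrite -[r in (p ^ r)%N]card_ord -[p in (p ^ _)%N]card_ord -card_ffun.
apply: (covering_finite smA (r := @residue_sum r p (fun i => eta ^+ i)) _).2.
move=> _ [_ [P _ <-] [a aA <-]].
pose R := Pdiv.Ring.rmodp P q.
have szR : (size R <= r)%N by rewrite -ltnS -szq Pdiv.Ring.ltn_rmodp monic_neq0.
have [f [b RE]] := residue_sumP (fun i : 'I_r => eta ^+ i) (fun i => R`_i) p0.
exists f; rewrite (Pdiv.RingMonic.rdivp_eq mq P) -/R rmorphD rmorphM /= hornerD hornerM.
rewrite (horner_sum_ord _ szR) RE [residue_sum _ f + _]addrC addrA -addrA addrAC.
rewrite addrA addrK.
case: qp => c cA <-.
set s := (map_poly _ _).[eta]; set t := \sum_i _.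
exists (s * c + t + a); last by rewrite !mulrnDl mulrnAr.
have [sI cI aI] : [/\ s \in algint K, c \in algint K & a \in algint K].
  by split; [exact: horner_int_closed | exact/algintP | exact/algintP].
apply/algintP; rewrite rpredD// rpredD ?rpredM// rpred_sum// => i _.
by rewrite rpredMz ?rpredX.
Qed.

Lemma dvdn_index_zadjoin p eta (q : {poly int}) r : prime p ->
  eta \in algint K -> q \is monic -> size q = r.+1 ->
  multiples p A (map_poly intr q).[eta] ->
  (p ^ (d - r) %| subgroup_index A (Zadjoin eta))%N.
Proof.
move=> pp etaA mq szq qp.
have [finH dvdH] := dvdn_index_adjoin_mod pp etaA mq szq qp.
(* An infinite index is recorded as 0, which every power of [p] divides. *)
have [finB|infB] := pselect (finite_index A (Zadjoin eta)); last first.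
  by rewrite (infinite_index infB) dvdn0.
apply: (dvdn_trans dvdH); apply: index_dvdn finB => //.
- exact: subgroup_algint.
- exact: subgroup_adjoin_mod.
- exact: subgroup_zadjoin.
- move=> _ [b bB [a aA <-]]; have sA := subgroup_algint.
  exact: subgroupD sA (zadjoin_algint etaA bB) (subgroupMn _ sA aA).
- move=> b bB; exists b => //; exists 0; first exact: subgroup0 subgroup_algint.
  by rewrite mul0rn addr0.
Qed.

End Generator.
End Index.

(** * Upper bounds for the power of p in an index *)

Section SpanMod.
Variables (K : fieldExtType rat) (eta : K) (k : nat) (u : 'I_k -> K) (p : nat).

Definition span_mod : {pred K} := fun x => `[< exists b (c : 'I_k -> int) a,
  [/\ b \in zadjoin eta, a \in algint K &
      x = b + \sum_i u i *~ c i + a *+ p] >].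

Lemma span_modP x :
  reflect (exists b (c : 'I_k -> int) a,
    [/\ b \in zadjoin eta, a \in algint K &
        x = b + \sum_i u i *~ c i + a *+ p]) (x \in span_mod).
Proof. exact: asboolP. Qed.

Fact span_mod_zmod : zmod_closed span_mod.
Proof.
split=> [|_ _ /span_modP[b [c [a [bB aA ->]]]] /span_modP[b' [c' [a' [b'B a'A ->]]]]].
  apply/span_modP; exists 0, (fun=> 0), 0; rewrite !rpred0; split=> //.
  by rewrite big1// !add0r mul0rn.
apply/span_modP; exists (b - b'), (fun i => c i - c' i), (a - a').
rewrite !rpredB//; split=> //; rewrite mulrnBl.
have -> : \sum_i u i *~ (c i - c' i) = \sum_i u i *~ c i - \sum_i u i *~ c' i.
  by rewrite -sumrB; apply: eq_bigr => i _; rewrite mulrzBr.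
by ring.
Qed.
HB.instance Definition _ := GRing.isZmodClosed.Build K span_mod span_mod_zmod.

Lemma span_mod_zadjoin b : b \in zadjoin eta -> b \in span_mod.
Proof.
move=> bB; apply/span_modP; exists b, (fun=> 0), 0; rewrite rpred0; split=> //.
by rewrite big1// !addr0 mul0rn addr0.
Qed.

Lemma span_mod_gen i : u i \in span_mod.
Proof.
apply/span_modP; exists 0, (fun j => (j == i : nat)), 0; rewrite !rpred0; split=> //.
rewrite mul0rn addr0 add0r (bigD1 i)//= eqxx big1 ?addr0// => j /negPf ->.
by rewrite mulr0z.
Qed.

Lemma span_mod_mulrn a : a \in algint K -> a *+ p \in span_mod.
Proof.
move=> aA; apply/span_modP; exists 0, (fun=> 0), a; rewrite rpred0; split=> //.
by rewrite big1// !add0r.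
Qed.

End SpanMod.

Section Upper.
Variable K : fieldExtType rat.
Local Notation A := (@ring_of_integers K).
Local Notation d := (\dim {:K}).
Variable theta : K.
Hypothesis thetaA : theta \in algint K.
Hypothesis gen : <<1; theta>>%VS = fullv :> {vspace K}.

(* If [Q(eta)] were a proper subfield, its degree would be at most half of
   [d], so that [p ^ k.+1] would divide the index of [Z[eta] + pA]. *)
Lemma index_zadjoin_upper p k (eta : K) (u : 'I_k -> K) : prime p ->
  (2 * k < d)%N -> eta \in algint K -> (forall i, u i \in algint K) ->
  (forall i, u i *+ p \in zadjoin eta) ->
  {subset algint K <= span_mod eta u p} ->
  <<1; eta>>%VS = fullv :> {vspace K} /\
  ~~ (p ^ k.+1 %| subgroup_index A (Zadjoin eta))%N.
Proof.
move=> pp kd etaA uA puB spanA; have p0 := prime_gt0 pp; have p1 := prime_gt1 pp.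
have sA := @subgroup_algint K; have sB := subgroup_zadjoin eta.
have sH := subgroup_adjoin_mod eta p.
have geneta : <<1; eta>>%VS = fullv :> {vspace K}.
  apply/eqP; rewrite eqEdim subvf /= leqNgt; apply/negP => ed.
  have [q [mq szq] q0] := integral_min_poly etaA.
  have qp : multiples p A (map_poly intr q).[eta].
    by exists 0; [exact: subgroup0 sA | rewrite q0 mul0rn].
  have [fin dvdH] := dvdn_index_adjoin_mod thetaA gen pp etaA mq szq qp.
  have lek : (subgroup_index A (adjoin_mod eta p) <= p ^ k)%N.
    rewrite -[k in (p ^ k)%N]card_ord -[p in (p ^ _)%N]card_ord -card_ffun.
    apply: (covering_finite sH (r := @residue_sum K k p u) _).2.
    move=> x /algintP/spanA/span_modP[b [c [a [bB aA ->]]]].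
    have [f [e ->]] := residue_sumP u c p0; exists f.
    exists b; first exact/asboolP.
    exists (\sum_i u i *~ e i + a); last by rewrite mulrnDl; ring.
    by apply/algintP; rewrite rpredD// rpred_sum// => i _; rewrite rpredMz ?uA.
  have := leq_trans (dvdn_leq (subgroup_index_gt0 sA sH fin) dvdH) lek.
  rewrite leq_exp2l//.
  have /dvdnP[m mE] : (\dim <<1; eta>> %| d)%N by apply: field_dimS; exact: subvf.
  move: ed; rewrite mE -[X in (X < _)%N]mul1n ltn_mul2r => /andP[_ m1].
  have : (2 * \dim <<1; eta>> <= m * \dim <<1; eta>>)%N by rewrite leq_mul2r m1 orbT.
  by move: kd; rewrite mE; lia.
split=> //; pose C : set K := [set x | exists b (c : 'I_k -> int),
  b \in zadjoin eta /\ x = b + \sum_i u i *~ c i].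
have sC : subgroup C.
  split=> [|_ _ [b [c [bB ->]]] [b' [c' [b'B ->]]]].
    exists 0, (fun=> 0); rewrite rpred0 add0r big1//.
  exists (b - b'), (fun i => c i - c' i); rewrite rpredB//; split=> //.
  by rewrite opprD addrACA -sumrB; congr (_ + _); apply: eq_bigr => i _; rewrite mulrzBr.
have BC : Zadjoin eta `<=` C.
  move=> b bB; exists b, (fun=> 0); split; first exact/asboolP.
  by rewrite big1 ?addr0.
have CA : C `<=` A.
  move=> _ [b [c [bB ->]]]; apply/algintP; rewrite rpredD//.
    by apply/algintP/(zadjoin_algint etaA)/asboolP.
  by rewrite rpred_sum// => i _; rewrite rpredMz ?uA.
have [N [N0 den]] := bounded_denominators etaA geneta.
have NAB : multiples N A `<=` Zadjoin eta.
  by move=> _ [x /algintP/den[P _ ->] <-]; exists P.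
have [finAB _] := index_between thetaA gen N0 sB NAB (subset_trans BC CA).
(* Nakayama by hand: iterating [A = C + pA] up to the exponent of [p] in [N] absorbs that part of
   the denominator. What remains is [N' A] inside [C] with [N'] prime to [p], so [(A : C)] is prime
   to [p]. *)
have iterC s x : A x -> exists2 c, C c & exists2 a, A a & x = c + a *+ p ^ s.
  elim: s => [|s IHs] in x * => Ax.
    by exists 0; [exact: subgroup0 sC | exists x; rewrite ?add0r].
  have /algintP/spanA/span_modP[b [c [a [bB /algintP aA ->]]]] := Ax.
  have [c' c'C [a' a'A ->]] := IHs a aA.
  exists (b + \sum_i u i *~ c i + c' *+ p).
    by apply: subgroupD sC _ (subgroupMn _ sC c'C); exists b, c.
  by exists a'; rewrite // mulrnDl addrA -mulrnA -expnSr.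
have [N' cN' NE] := pfactor_coprime pp N0.
have N'0 : (0 < N')%N by move: N0; rewrite NE muln_gt0 => /andP[].
have N'AC : multiples N' A `<=` C.
  move=> _ [x Ax <-]; have [c cC [a aA ->]] := iterC (logn p N) x Ax.
  rewrite mulrnDl -mulrnA mulnC -NE; apply: subgroupD sC (subgroupMn _ sC cC) _.
  by apply/BC/NAB; exists a.
have [finAC dvdAC] := index_between thetaA gen N'0 sC N'AC CA.
have [_ finCB] := finite_index_sub sC sB CA BC finAB.
have [_ ->] := index_tower sA sC sB CA BC finAC finCB.
have cpAC : coprime (p ^ k.+1) (subgroup_index A C).
  by rewrite coprimeXl// (coprime_dvdr dvdAC)// coprimeXr.
rewrite Gauss_dvdr//; apply/negP => /(dvdn_leq (subgroup_index_gt0 sC sB finCB)).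
apply/negP; rewrite -ltnNge.
(* Because each [p u_i] lies in [Z[eta]], the coefficient of [u_i] matters only modulo [p]. *)
suff : (subgroup_index C (Zadjoin eta) <= p ^ k)%N.
  by move=> /leq_ltn_trans; apply; rewrite ltn_exp2l.
rewrite -[k in (p ^ k)%N]card_ord -[p in (p ^ _)%N]card_ord -card_ffun.
apply: (covering_finite sB (r := @residue_sum K k p u) _).2.
move=> _ [b [c [bB ->]]]; have [f [e ->]] := residue_sumP u c p0; exists f.
have -> : b + (residue_sum u f + (\sum_i u i *~ e i) *+ p) - residue_sum u f =
  b + (\sum_i u i *~ e i) *+ p by ring.
apply/asboolP; change (b + (\sum_i u i *~ e i) *+ p \in zadjoin eta).
rewrite rpredD// -sumrMnl rpred_sum// => i _.
rewrite pmulrn mulrzAC -pmulrn; apply: rpredMz; exact: puB.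
Qed.

End Upper.

(** * Orders maximal at a prime *)

Section Ideal.
Variables (K : fieldExtType rat) (S : subringClosed K) (c : K) (n : nat).

(** The generator [c] is there for the prime 3, where the radical is generated by [de] and 3;
    [c = 0] gives the multiples of [n]. *)
Definition ideal : {pred K} := fun x =>
  `[< exists w z, [/\ w \in S, z \in S & x = c * w + z *+ n] >].

Lemma idealP x :
  reflect (exists w z, [/\ w \in S, z \in S & x = c * w + z *+ n]) (x \in ideal).
Proof. exact: asboolP. Qed.

Fact ideal_zmod : zmod_closed ideal.
Proof.
split=> [|_ _ /idealP[w [z [wS zS ->]]] /idealP[w' [z' [w'S z'S ->]]]].
  by apply/idealP; exists 0, 0; rewrite rpred0; split=> //; rewrite mulr0 mul0rn addr0.
apply/idealP; exists (w - w'), (z - z'); rewrite !rpredB//; split=> //.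
by rewrite mulrnBl; ring.
Qed.
HB.instance Definition _ := GRing.isZmodClosed.Build K ideal ideal_zmod.

Lemma idealMl x y : x \in S -> y \in ideal -> x * y \in ideal.
Proof.
move=> xS /idealP[w [z [wS zS ->]]]; apply/idealP.
exists (x * w), (x * z); rewrite !rpredM//; split=> //.
by rewrite mulrDr mulrnAr; ring.
Qed.

Lemma idealMr x y : x \in ideal -> y \in S -> x * y \in ideal.
Proof. by move=> xI yS; rewrite mulrC idealMl. Qed.

Lemma ideal_gen w : w \in S -> c * w \in ideal.
Proof. by move=> wS; apply/idealP; exists w, 0; rewrite rpred0 mul0rn addr0. Qed.

Lemma ideal_mulrn z : z \in S -> z *+ n \in ideal.
Proof. by move=> zS; apply/idealP; exists 0, z; rewrite rpred0 mulr0 add0r. Qed.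

End Ideal.

Arguments ideal {K} S c n.

Lemma ideal0P (K : fieldExtType rat) (S : subringClosed K) n x :
  reflect (exists2 z, z \in S & x = z *+ n) (x \in ideal S 0 n).
Proof.
apply: (iffP (idealP _ _ _ _)) => [[w [z [_ zS ->]]]|[z zS ->]].
  by exists z; rewrite // mul0r add0r.
by exists 0, z; rewrite rpred0 mul0r add0r.
Qed.

(** * Orders generated by two elements *)

Section Subring2.
Variables (K : fieldExtType rat) (th om : K).

(** Z[th, om] as an intersection of subrings: properties pass from the generators by induction,
    without bivariate polynomials or a basis. *)
Definition subring2 : {pred K} := fun x =>
  `[< forall S : {pred K}, subring_closed S -> th \in S -> om \in S -> x \in S >].

Fact subring2_subring : subring_closed subring2.
Proof.
split=> [|x y /asboolP Sx /asboolP Sy|x y /asboolP Sx /asboolP Sy].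
- by apply/asboolP => S [].
- by apply/asboolP => S cS thS omS; case: (cS) => _ SB _; apply: SB; [exact: Sx | exact: Sy].
- by apply/asboolP => S cS thS omS; case: (cS) => _ _ SM; apply: SM; [exact: Sx | exact: Sy].
Qed.
HB.instance Definition _ := GRing.isSubringClosed.Build K subring2 subring2_subring.

Lemma subring2_l : th \in subring2.
Proof. by apply/asboolP. Qed.

Lemma subring2_r : om \in subring2.
Proof. by apply/asboolP. Qed.

Lemma subring2_sub (S : subringClosed K) :
  th \in S -> om \in S -> {subset subring2 <= S}.
Proof.
move=> thS omS x /asboolP; apply=> //; split; first exact: rpred1.
  by move=> y z; apply: rpredB.
by move=> y z; apply: rpredM.
Qed.

(* The multipliers [y] with [y * W] inside [W] form a subring. *)
Lemma subring2_ind (W : {pred K}) : zmod_closed W -> 1 \in W ->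
  {in W, forall x, th * x \in W} -> {in W, forall x, om * x \in W} ->
  {subset subring2 <= W}.
Proof.
move=> [W0 WB] W1 thW omW x /asboolP.
move=> /(_ (fun y => `[< {in W, forall z, y * z \in W} >])).
have h : subring_closed (fun y => `[< {in W, forall z, y * z \in W} >]).
  split=> [|y z /asboolP yW /asboolP zW|y z /asboolP yW /asboolP zW].
  - by apply/asboolP => z zW; rewrite mul1r.
  - by apply/asboolP => t tW; rewrite mulrBl; apply: WB; [exact: yW | exact: zW].
  - by apply/asboolP => t tW; rewrite -mulrA; apply: yW; exact: zW.
move=> /(_ h) xW.
have /asboolP/(_ 1 W1) : x \in (fun y => `[< {in W, forall z, y * z \in W} >]).
  by apply: xW; apply/asboolP.
by rewrite mulr1.
Qed.

Section Frobenius.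
Variables (c : K) (n q : nat).
Local Notation J := (ideal subring2 c n).
Hypothesis powB : {in subring2 &, forall x y, (x - y) ^+ q - (x ^+ q - y ^+ q) \in J}.
Hypothesis powl : th ^+ q - th \in J.
Hypothesis powr : om ^+ q - om \in J.

(** Once the [q]-th power map is additive modulo [J], its fixed elements form a subring modulo [J],
    so checking the two generators is enough. *)
Lemma pow_sub_ideal : {in subring2, forall y, y ^+ q - y \in J}.
Proof.
move=> y yS.
pose T : {pred K} := fun y => (y \in subring2) && (y ^+ q - y \in J).
suff : y \in T by case/andP.
move: yS => /asboolP; apply; last 2 first.
- by apply/andP; split=> //; exact: subring2_l.
- by apply/andP; split=> //; exact: subring2_r.
split=> [|x z /andP[xS xT] /andP[zS zT]|x z /andP[xS xT] /andP[zS zT]].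
- by rewrite /T -topredE /= rpred1 expr1n subrr rpred0.
- apply/andP; split; first exact: rpredB.
  have -> : (x - z) ^+ q - (x - z) =
      ((x - z) ^+ q - (x ^+ q - z ^+ q)) + ((x ^+ q - x) - (z ^+ q - z)) by ring.
  by rewrite rpredD ?powB// rpredB.
- apply/andP; split; first exact: rpredM.
  have -> : (x * z) ^+ q - x * z = x ^+ q * (z ^+ q - z) + (x ^+ q - x) * z.
    by rewrite exprMn; ring.
  by rewrite rpredD//; [apply: idealMl => //; exact: rpredX | exact: idealMr].
Qed.

End Frobenius.

(** Iterating the power map, [y] agrees modulo the ideal with [y ^+ (q ^ m)], and [q ^ m] is at
    least [m]. *)
Lemma ideal_radical c n q y m : (1 < q)%N ->
  {in subring2, forall y, y ^+ q - y \in ideal subring2 c n} ->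
  y \in subring2 -> y ^+ m \in ideal subring2 c n -> y \in ideal subring2 c n.
Proof.
move=> q_gt1 powI yS ym; set J := ideal _ _ _ in powI ym *.
have powk k : y ^+ (q ^ k) - y \in J.
  elim: k => [|k IHk]; first by rewrite expn0 expr1 subrr rpred0.
  have -> : y ^+ (q ^ k.+1) - y =
      ((y ^+ (q ^ k)) ^+ q - y ^+ (q ^ k)) + (y ^+ (q ^ k) - y).
    by rewrite -exprM -expnSr; ring.
  by rewrite rpredD//; apply: powI; exact: rpredX.
have mq : (m <= q ^ m)%N by apply/ltnW/ltn_expl.
have -> : y = y ^+ (q ^ m - m) * y ^+ m - (y ^+ (q ^ m) - y).
  by rewrite -exprD subnK//; ring.
by rewrite rpredB ?powk//; apply: idealMl => //; exact: rpredX.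
Qed.

(** Multiplying the monic equation of [x] by [p ^ m] gives one for [p x] whose lower coefficients
    are all divisible by [p]. Thus an integer with denominator [p] produces a nilpotent class in
    [O / pO], and maximality becomes a question about the nilradical. *)
Lemma integral_pow_ideal (p : nat) x : x \in algint K -> x *+ p \in subring2 ->
  exists m, (x *+ p) ^+ m \in ideal subring2 0 p.
Proof.
move=> /algintP[Q mQ rQ] yS; set y := x *+ p.
have [m szQ] : exists m, size Q = m.+1.
  by exists (size Q).-1; rewrite prednK// lt0n size_poly_eq0 monic_neq0.
exists m; apply/ideal0P.
exists (- \sum_(i < m) (Q`_i)%:~R * p%:R ^+ (m - i.+1) * y ^+ i).
  rewrite rpredN rpred_sum// => i _.
  by rewrite !rpredM ?rpred_int ?rpredX ?rpred_nat.
have := rQ; rewrite /root (horner_coef_wide _ (size_poly _ _)) szQ => /eqP Q0.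
have : \sum_(i < m.+1) (Q`_i)%:~R * p%:R ^+ (m - i) * y ^+ i = 0.
  apply: etrans (etrans (congr1 ( *%R (p%:R ^+ m)) Q0) (mulr0 _)).
  rewrite mulr_sumr; apply: eq_bigr => i _.
  rewrite coef_poly ltn_ord /y -[x *+ p]mulr_natl exprMn.
  have -> : p%:R ^+ m = p%:R ^+ (m - i) * p%:R ^+ i :> K.
    by rewrite -exprD subnK ?leq_ord.
  by ring.
rewrite big_ord_recr /= subnn expr0 mulr1.
have -> : Q`_m = 1 by move/monicP: mQ; rewrite /lead_coef szQ.
rewrite mul1r => /eqP; rewrite addrC addr_eq0 => /eqP ->.
rewrite mulNrn -sumrMnl; congr (- _); apply: eq_bigr => i _.
rewrite -[_ *+ p]mulr_natl -(subnSK (ltn_ord i)) exprS.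
by ring.
Qed.

(** When [O] lies in [A], this says that [A / O] has no [p]-torsion. *)
Definition maximal_at (p : nat) :=
  forall x, x \in algint K -> x *+ p \in subring2 -> x \in subring2.

(** Maximality strips the [p]-part from a denominator of [x], leaving [N' x] in [O] with [N'] prime
    to [p]. A Bezout relation between [N'] and [p] then splits [x]. *)
Lemma maximal_at_span p : prime p -> th \in algint K ->
  <<1; th>>%VS = fullv :> {vspace K} -> maximal_at p ->
  forall x, x \in algint K ->
    exists o a, [/\ o \in subring2, a \in algint K & x = o + a *+ p].
Proof.
move=> pp thA gen pmax x xA; have p0 := prime_gt0 pp.
have [N [N0 den]] := bounded_denominators thA gen.
have [N' cN' NE] := pfactor_coprime pp N0.
have xS s y : y \in algint K -> y *+ (p ^ s) \in subring2 -> y \in subring2.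
  elim: s y => [y _|s IHs y yA]; first by rewrite expn0.
  by rewrite expnSr mulrnA => /pmax h; apply: IHs => //; apply: h; rewrite rpredMn.
have x'S : x *+ N' \in subring2.
  apply: (xS (logn p N)); first exact: rpredMn.
  rewrite -mulrnA -NE.
  have [P _ ->] := den x xA; apply: horner_int_closed; exact: subring2_l.
have [u [v uv]] : exists u v : int, u * N' + v * p = 1.
  have [u [v uv]] := Bezoutz N' p; exists u, v; rewrite uv /gcdz /= gcdnC.
  by rewrite (eqP cN').
exists (x *+ N' *~ u), (x *~ v); rewrite !rpredMz//; split=> //.
rewrite !pmulrn -!mulrzA -mulrzDr.
by rewrite [N'%:Z * u]mulrC uv.
Qed.

End Subring2.

Lemma horner_int_cong (K : fieldExtType rat) (S : subringClosed K) n
  (q : {poly int}) x a : x \in S -> a \in S ->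
  exists2 b, b \in S &
    (map_poly intr q).[x + a *+ n] = (map_poly intr q).[x] + b *+ n.
Proof.
move=> xS aS; elim/poly_ind: q => [|q k [b bS qE]].
  by exists 0; rewrite ?rpred0// rmorph0 !horner0 mul0rn addr0.
exists ((map_poly intr q).[x] * a + b * x + b * a *+ n).
  by rewrite !rpredD ?rpredMn ?rpredM// horner_int_closed.
rewrite rmorphD rmorphM /= map_polyX map_polyC !hornerE qE.
by ring.
Qed.

(** * The prime 2 *)

Ltac in_subring := by rewrite ?(rpredB, rpredD, rpredN, rpredM, rpredX, rpredMn,
  rpredMz, rpred1, rpred0, rpred_nat, rpred_int).

Section Two.
Variables (K : fieldExtType rat) (th om g : K).
Hypotheses (thA : th \in algint K) (omA : om \in algint K).
Hypothesis gZ : g \in zadjoin th.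
Hypothesis th3 : th ^+ 3 = 1 + om *+ 2.
Hypothesis om2 : om ^+ 2 = - om - g *+ 2.

Local Notation O := (subring2 th om).
Local Notation J := (ideal O 0 2).

Let thO : th \in O := subring2_l th om.
Let omO : om \in O := subring2_r th om.
Let gO : g \in O.
Proof. exact: zadjoin_sub gZ. Qed.

Let two_neq0 : 2%:R != 0 :> K.
Proof. exact: natr_neq0. Qed.

(* [omE] and [gE] turn every identity below into one between polynomials in the
   free variable [th], which [field] can check. *)
Let omE : om = (th ^+ 3 - 1) / 2%:R.
Proof. by rewrite th3; field. Qed.

Let gE : g = - (om ^+ 2 + om) / 2%:R.
Proof. by rewrite om2; field. Qed.

(** The fourth power is Frobenius applied twice, hence additive modulo 2. On the generators,
    [th ^+ 3 = 1] and [om ^+ 2 = om] modulo 2. *)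
Lemma pow4_sub_ideal : {in O, forall y, y ^+ 4 - y \in J}.
Proof.
apply: pow_sub_ideal => [x y xO yO||]; apply/ideal0P.
- exists (- x ^+ 3 * y *+ 2 + x ^+ 2 * y ^+ 2 *+ 3 - x * y ^+ 3 *+ 2 + y ^+ 4).
    in_subring.
  by ring.
- exists (om * th); first in_subring.
  by rewrite omE; field.
- exists (- om - g + g * om *+ 2 + g ^+ 2 *+ 2); first in_subring.
  by rewrite gE omE; field.
Qed.

Lemma maximal_at2 : maximal_at th om 2.
Proof.
move=> x xA x2O; have [m xm] := integral_pow_ideal xA x2O.
have /ideal0P[z zO] := ideal_radical (isT : (1 < 4)%N) pow4_sub_ideal x2O xm.
by move=> /(natmul_inj (isT : (0 < 2)%N)) ->.
Qed.

Hypothesis gen : <<1; th>>%VS = fullv :> {vspace K}.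

Let span2 x : x \in algint K ->
  exists o a, [/\ o \in O, a \in algint K & x = o + a *+ 2].
Proof. exact: maximal_at_span (isT : prime 2) thA gen maximal_at2 x. Qed.

Let OA : {subset O <= algint K}.
Proof. exact: subring2_sub. Qed.

Lemma dvdn_index2 eta : eta \in algint K -> \dim {:K} = 6%N ->
  (2 ^ 2 %| subgroup_index (@ring_of_integers K) (Zadjoin eta))%N.
Proof.
move=> etaA dimK.
have := @dvdn_index_zadjoin K th thA gen 2 eta ('X^4 - 'X) 4 isT etaA.
rewrite dimK; apply.
- by rewrite monicE lead_coefDl ?lead_coefXn// size_polyN size_polyX size_polyXn.
- by rewrite size_polyDl ?size_polyXn// size_polyN size_polyX.
have [o [a [oO aA ->]]] := span2 etaA.
have [b bA ->] := horner_int_cong 2 ('X^4 - 'X) (OA oO) aA.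
have /ideal0P[z /OA zA zE] := pow4_sub_ideal oO.
exists (z + b); first (apply/algintP; in_subring).
by rewrite rmorphB /= map_polyXn map_polyX hornerD hornerN hornerXn hornerX zE mulrnDl.
Qed.

Local Notation e := (1 + th + th ^+ 2).

(** Since [e * th = e + 2 om], a polynomial in [th] acts on [e] modulo 2 as its value at 1. This
    controls [e * g] for the unspecified [g]. *)
Let e_eigen x : x \in zadjoin th ->
  exists n : int, exists2 z, z \in O & e * x = e *~ n + z *+ 2.
Proof.
move=> /zadjoinP[P ->]; elim/poly_ind: P => [|P c [n [z zO PE]]].
  by exists 0, 0; rewrite ?rpred0// rmorph0 horner0 mulr0 mulr0z mul0rn addr0.
exists (n + c), (om *~ n + z * th); first in_subring.
rewrite rmorphD rmorphM /= map_polyX map_polyC !hornerE /= mulrDr mulrA PE.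
have -> : (e *~ n + z *+ 2) * th = (e * th) *~ n + z * th *+ 2 by ring.
have -> : e * th = e + om *+ 2 by rewrite omE; field.
by ring.
Qed.

(* Modulo 2, [om] is idempotent and [O / 2O] is (F_2 * F_4) ^ 2, [e] being the
   idempotent of the two factors F_2.  [eta] takes distinct values on these and
   the same value on both copies of F_4; the summand [2 * om] makes the minimal
   polynomials over those copies differ modulo 4. *)
Let eta := th + om * (e + 2%:R).
(** The equation [X^4 = X] holds at [eta] only modulo 2; half of the error is the element that
    supplements [Z[eta]], together with its product by [eta]. *)
Let u := (eta ^+ 4 - eta) / 2%:R.

Let etaO : eta \in O.
Proof. rewrite /eta; in_subring. Qed.

Let u2 : u *+ 2 = eta ^+ 4 - eta.
Proof. by rewrite /u; field. Qed.

Let uO : u \in O.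
Proof.
have /ideal0P[z zO zE] := pow4_sub_ideal etaO.
by rewrite (natmul_inj (isT : (0 < 2)%N) (etrans u2 zE)).
Qed.

(** This and the next three are reductions modulo 2 by [th ^+ 3 = 1], [om ^+ 2 = om] and
    [e * th = e]; each long witness is the difference of the two sides divided by 2. *)
Let eta2E : exists2 z, z \in O & eta ^+ 2 = th ^+ 2 + om * e + z *+ 2.
Proof.
exists (- g *+ 11 - om *+ 5 - om * g *+ 4 - th * g *+ 5
        - th * om * g *+ 2 - th ^+ 2 * g *+ 7 - th ^+ 2 * om *+ 3); first in_subring.
by rewrite /eta gE omE; field.
Qed.

Let eta3E : exists2 z, z \in O & eta ^+ 3 = 1 + om * e + z *+ 2.
Proof.
have [z zO zE] := eta2E.
exists (- g *+ 5 - om - om * g *+ 4 - th * g *+ 5 - th * om *+ 2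
        - th * om * g *+ 2 - th ^+ 2 * g *+ 5 - th ^+ 2 * om + eta * z).
  in_subring.
by rewrite exprS zE /eta gE omE; field.
Qed.

Let uE : exists2 z, z \in O & u = om * (e + 1) + e * g + z *+ 2.
Proof.
have [z zO zE] := eta2E; pose s := th ^+ 2 + om * e.
exists (- g *+ 2 - om *+ 2 - om * g *+ 2 - th * g *+ 3 - th * om - th * om * g
        - th ^+ 2 * g *+ 2 - th ^+ 2 * om + (s * z + z ^+ 2)).
  rewrite /s; in_subring.
have -> : u = ((s + z *+ 2) ^+ 2 - eta) / 2%:R by rewrite /s -zE /u -exprM.
by rewrite /eta /s gE omE; field.
Qed.

Let eta_uE : exists2 z, z \in O &
  u * eta = om * (e + th) + (e + om * e) * g + z *+ 2.
Proof.
have [z zO ->] := uE.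
exists (- g *+ 6 - g ^+ 2 *+ 4 - om *+ 3 - om * g *+ 3 - th * g *+ 4
        - th * g ^+ 2 *+ 2 - th * om *+ 2 - th * om * g - th ^+ 2 * g *+ 6
        - th ^+ 2 * om *+ 3 + th ^+ 2 * om * g *+ 2 + eta * z); first in_subring.
by rewrite /eta gE omE; field.
Qed.

Let w (i : 'I_2) := u * eta ^+ i.
Local Notation M := (span_mod eta w 2).

(** The reductions are triangular: [eta ^+ 3] yields [om * e], then [eta] and [eta ^+ 2] yield [th]
    and [th ^+ 2], [u] yields [om], and [u * eta] yields [om * th]. *)
Let OM : {subset O <= M}.
Proof.
have M2 z : z \in O -> z *+ 2 \in M by move=> /OA; exact: span_mod_mulrn.
have M1 : 1 \in M by apply: span_mod_zadjoin; exact: rpred1.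
have Meta n : eta ^+ n \in M.
  by apply: span_mod_zadjoin; apply: rpredX; exact: zadjoin_gen.
have Mu : u \in M by have := span_mod_gen eta w 2 ord0; rewrite /w expr0 mulr1.
have Mu' : u * eta \in M by have := span_mod_gen eta w 2 ord_max; rewrite /w expr1.
have Mome : om * e \in M.
  have [z zO zE] := eta3E; have -> : om * e = eta ^+ 3 - 1 - z *+ 2 by rewrite zE; ring.
  by rewrite !rpredB ?Meta//; exact: M2.
have Mth : th \in M.
  have -> : th = eta ^+ 1 - om * e - om *+ 2 by rewrite /eta; ring.
  by rewrite !rpredB ?Meta//; exact: M2.
have Mth2 : th ^+ 2 \in M.
  have [z zO zE] := eta2E.
  have -> : th ^+ 2 = eta ^+ 2 - om * e - z *+ 2 by rewrite zE; ring.
  by rewrite !rpredB ?Meta//; exact: M2.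
have Me : e \in M by rewrite !rpredD.
have [n [y yO eg]] := e_eigen gZ.
have Meg : e * g \in M by rewrite eg rpredD ?rpredMz//; exact: M2.
have Momeg : om * e * g \in M.
  have -> : om * e * g = (om * e) *~ n + (om * y) *+ 2 by rewrite -mulrA eg; ring.
  by rewrite rpredD ?rpredMz//; apply: M2; exact: rpredM.
have Mome1 : om * (e + 1) \in M.
  have [z zO zE] := uE.
  have -> : om * (e + 1) = u - e * g - z *+ 2 by rewrite zE; ring.
  by rewrite !rpredB ?Meta//; exact: M2.
have Mom : om \in M.
  have -> : om = om * (e + 1) - om * e by ring.
  by rewrite rpredB.
have Momth : om * th \in M.
  have [z zO zE] := eta_uE.
  have -> : om * th = u * eta - om * e - e * g - om * e * g - z *+ 2 by rewrite zE; ring.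
  by rewrite !rpredB ?Meta//; exact: M2.
have Momth2 : om * th ^+ 2 \in M.
  have -> : om * th ^+ 2 = om * e - om - om * th by ring.
  by rewrite !rpredB.
(* The span of the six monomials [th ^+ i * om ^+ j] with [i < 3], [j < 2], enlarged by [2 O], is
   stable under both generators, hence contains [O]. *)
pose W : {pred K} := fun x => `[< exists n0 n1 n2 n3 n4 n5 : int, exists2 z, z \in O &
  x = n0%:~R + th *~ n1 + th ^+ 2 *~ n2
      + om *~ n3 + (om * th) *~ n4 + (om * th ^+ 2) *~ n5 + z *+ 2 >].
have WM : {subset W <= M}.
  move=> x /asboolP[n0 [n1 [n2 [n3 [n4 [n5 [z zO ->]]]]]]].
  by apply: rpredD; [rewrite !rpredD ?rpredMz | exact: M2].
move=> x xO; apply: WM; apply: subring2_ind xO.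
- split=> [|_ _ /asboolP[n0 [n1 [n2 [n3 [n4 [n5 [z zO ->]]]]]]]
             /asboolP[m0 [m1 [m2 [m3 [m4 [m5 [t tO ->]]]]]]]]; apply/asboolP.
    by exists 0, 0, 0, 0, 0, 0; exists 0; [exact: rpred0 | ring].
  exists (n0 - m0), (n1 - m1), (n2 - m2), (n3 - m3), (n4 - m4), (n5 - m5), (z - t).
    in_subring.
  by ring.
- by apply/asboolP; exists 1, 0, 0, 0, 0, 0; exists 0; [exact: rpred0 | ring].
- move=> _ /asboolP[n0 [n1 [n2 [n3 [n4 [n5 [z zO ->]]]]]]]; apply/asboolP.
  exists n2, n0, n1, n5, n3, n4, (om *~ n2 + om ^+ 2 *~ n5 + th * z); first in_subring.
  by rewrite omE; field.
- move=> _ /asboolP[n0 [n1 [n2 [n3 [n4 [n5 [z zO ->]]]]]]]; apply/asboolP.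
  exists 0, 0, 0, (n0 + n3), (n1 + n4), (n2 + n5).
  exists (- (om + g) * (n3%:~R + th *~ n4 + th ^+ 2 *~ n5) + om * z); first in_subring.
  by rewrite gE omE; field.
Qed.

Lemma index2_witness : \dim {:K} = 6%N -> exists eta,
  [/\ eta \in algint K, <<1; eta>>%VS = fullv :> {vspace K} &
      ~~ (2 ^ 3 %| subgroup_index (@ring_of_integers K) (Zadjoin eta))%N].
Proof.
move=> dimK; exists eta; have etaA := OA etaO.
have [] := @index_zadjoin_upper K th thA gen 2 2 eta w isT; rewrite ?dimK//.
- by move=> i; rewrite /w rpredM ?rpredX// OA.
- move=> i; rewrite /w -mulrnAl u2 rpredM ?rpredX ?zadjoin_gen// rpredB//.
    by rewrite rpredX// zadjoin_gen.
  exact: zadjoin_gen.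
- move=> x /span2[o [a [oO aA ->]]].
  by apply: rpredD; [exact: OM | exact: span_mod_mulrn].
Qed.

End Two.

(** * The prime 3 *)

Section Three.
Variables (K : fieldExtType rat) (th de om g : K).
Hypotheses (thA : th \in algint K) (omA : om \in algint K).
Hypothesis gZ : g \in zadjoin th.
Hypothesis th2 : th ^+ 2 = 1 + de.
Hypothesis de2 : de ^+ 2 = om *+ 3.
Hypothesis deom : de * om = - (g *+ 3) - de - om *+ 3.

Local Notation O := (subring2 th om).
Local Notation J := (ideal O de 3).

Let thO : th \in O := subring2_l th om.
Let omO : om \in O := subring2_r th om.
Let gO : g \in O.
Proof. exact: zadjoin_sub gZ. Qed.

Let three_neq0 : 3%:R != 0 :> K.
Proof. exact: natr_neq0. Qed.

Let deE : de = th ^+ 2 - 1.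
Proof. by rewrite th2; ring. Qed.

Let omE : om = de ^+ 2 / 3%:R.
Proof. by rewrite de2; field. Qed.

Let gE : g = - (de * om + de + om *+ 3) / 3%:R.
Proof. by rewrite deom; field. Qed.

Let deO : de \in O.
Proof. rewrite deE; in_subring. Qed.

(** Cubing is Frobenius at 3, and modulo [J] the generators satisfy [th ^+ 2 = 1] and
    [om ^+ 2 = - om], so all residues lie in F_3. *)
Lemma pow3_sub_ideal : {in O, forall y, y ^+ 3 - y \in J}.
Proof.
apply: pow_sub_ideal => [x y xO yO||]; apply/idealP.
- exists 0, (- x ^+ 2 * y + x * y ^+ 2); split; [in_subring | in_subring | ring].
- by exists th, 0; split; [in_subring | in_subring | rewrite deE; ring].
- exists (1 - g), (g + g ^+ 2 + om * g *+ 2); split; [in_subring | in_subring |].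
  by rewrite gE omE deE; field.
Qed.

(* If [3 y = de * w], then [3 y ^+ 2 = om * w ^+ 2] again lies in the radical
   [J]; multiplying by [de] annihilates it modulo 3, and [de * om = - de], so
   [de * w ^+ 2], and hence [de * w], vanishes modulo 3. *)
Lemma maximal_at3 : maximal_at th om 3.
Proof.
move=> x xA x3O; have [m xm] := integral_pow_ideal xA x3O.
have JS : {subset ideal O 0 3 <= J}.
  by move=> y /ideal0P[z zO ->]; exact: ideal_mulrn.
have /idealP[w [z [wO zO xE]]] :=
  ideal_radical (isT : (1 < 3)%N) pow3_sub_ideal x3O (JS _ xm).
pose y := x - z.
have y3 : y *+ 3 = de * w by rewrite mulrnBl xE addrK.
have [wz|] : y \in O \/ y \notin O by case: (y \in O); [left | right].
  by rewrite -(subrK z x) rpredD.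
have yA : y \in algint K by rewrite rpredB// (subring2_sub thA omA).
have y2O : y ^+ 2 *+ 3 \in O.
  have -> : y ^+ 2 *+ 3 = om * w ^+ 2.
    have -> : y = de * w / 3%:R by rewrite -y3; field.
    by rewrite omE; field.
  in_subring.
have [m' ym] := integral_pow_ideal (rpredX 2 yA) y2O.
have /idealP[w1 [z1 [w1O z1O yE]]] :=
  ideal_radical (isT : (1 < 3)%N) pow3_sub_ideal y2O (JS _ ym).
have /idealP[w2 [z2 [w2O z2O wE]]] := pow3_sub_ideal wO.
case/negP.
have -> : y = ((- g - om) * w ^+ 2 - om * w1 - de * z1) * w - om * w2 - de * z2.
  apply: (natmul_inj (isT : (0 < 3)%N)) => /=; rewrite y3.
  have omw : om * w ^+ 2 = de * w1 + z1 *+ 3.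
    rewrite -yE (_ : y = de * w / 3%:R); first by rewrite omE; field.
    by rewrite -y3; field.
  have wE' : w = w ^+ 3 - (de * w2 + z2 *+ 3) by rewrite -wE; ring.
  have -> : de * w = de * w ^+ 3 - de * (de * w2 + z2 *+ 3).
    by rewrite {1}wE'; ring.
  have -> : de * w ^+ 3 = ((- g - om) * w ^+ 2 *+ 3 - de * (om * w ^+ 2)) * w.
    by rewrite gE; field.
  by rewrite omw omE; field.
in_subring.
Qed.

Hypothesis gen : <<1; th>>%VS = fullv :> {vspace K}.

Let span3 x : x \in algint K ->
  exists o a, [/\ o \in O, a \in algint K & x = o + a *+ 3].
Proof. exact: maximal_at_span (isT : prime 3) thA gen maximal_at3 x. Qed.

Let OA : {subset O <= algint K}.
Proof. exact: subring2_sub. Qed.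

(* [O] acts on [de O / 3O] through F_3 * F_3. *)
Let de_eigen y : y \in O ->
  exists (s0 s1 : int), exists2 z, z \in O &
    de * y = de * (s0%:~R + th *~ s1) + z *+ 3.
Proof.
pose W : {pred K} := fun x => `[< exists (s0 s1 : int), exists2 z, z \in O &
    de * x = de * (s0%:~R + th *~ s1) + z *+ 3 >].
suff OW : {subset O <= W} by move=> /OW/asboolP.
apply: subring2_ind.
- split=> [|x t /asboolP[s0 [s1 [z zO xE]]] /asboolP[r0 [r1 [v vO tE]]]]; apply/asboolP.
    by exists 0, 0, 0; [exact: rpred0 | ring].
  exists (s0 - r0), (s1 - r1), (z - v); first in_subring.
  by rewrite mulrBr xE tE; ring.
- by apply/asboolP; exists 1, 0, 0; [exact: rpred0 | ring].
- move=> x /asboolP[s0 [s1 [z zO xE]]]; apply/asboolP.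
  exists s1, s0, (om *~ s1 + th * z); first in_subring.
  by rewrite mulrCA xE omE deE; field.
- move=> x /asboolP[s0 [s1 [z zO xE]]]; apply/asboolP.
  exists (- s0), (- s1), ((s0%:~R + th *~ s1) * (- g - om) + om * z); first in_subring.
  by rewrite mulrCA xE gE omE deE; field.
Qed.

(** The factor [X^3 - X] sends [o] into [de O + 3 O]. On [de O] modulo 3, [o] acts as
    [s0 + s1 * th], and the roots [s0 + s1], [s0 - s1] are its values at [th = 1] and [th = -1]: the
    product of the two linear factors becomes [s1 ^ 2 * de], and [de ^+ 2] is divisible by 3. *)
Lemma dvdn_index3 eta : eta \in algint K -> \dim {:K} = 6%N ->
  (3 ^ 1 %| subgroup_index (@ring_of_integers K) (Zadjoin eta))%N.
Proof.
move=> etaA dimK; have [o [a [oO aA ->]]] := span3 etaA.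
have [s0 [s1 [z zO zE]]] := de_eigen oO.
have /idealP[w [t [wO tO oE]]] := pow3_sub_ideal oO.
pose q : {poly int} := ('X^3 - 'X) * ('X - (s0 + s1)%:P) * ('X - (s0 - s1)%:P).
have m31 : size ('X^3 - 'X : {poly int}) = 4.
  by rewrite size_polyDl ?size_polyXn// size_polyN size_polyX.
have m3 : ('X^3 - 'X : {poly int}) \is monic.
  by rewrite monicE lead_coefDl ?lead_coefXn// size_polyN size_polyX size_polyXn.
have mq : q \is monic by rewrite !monicMl ?monicXsubC.
have szq : size q = 6.
  rewrite size_Mmonic ?size_XsubC ?monic_neq0 ?monicMl ?monicXsubC//.
  by rewrite size_Mmonic ?size_XsubC ?monic_neq0 ?monicXsubC// m31.
have := @dvdn_index_zadjoin K th thA gen 3 (o + a *+ 3) q 5 isT _ mq szq.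
rewrite dimK; apply.
  rewrite rpredD ?rpredMn// OA//.
have [b bA ->] := horner_int_cong 3 q (OA oO) aA.
have -> : (map_poly intr q).[o] =
    (o ^+ 3 - o) * (o - (s0%:~R + s1%:~R)) * (o - (s0%:~R - s1%:~R)) :> K.
  rewrite /q !rmorphM !rmorphB /= map_polyXn !map_polyX !map_polyC /=.
  by rewrite !(hornerM, hornerD, hornerN, hornerXn, hornerX, hornerC) mulrzDr.
pose r := t * (o - (s0%:~R + s1%:~R)) * (o - (s0%:~R - s1%:~R))
  + w * (z * (o - (s0%:~R - s1%:~R)) + (th - 1) * z *~ s1 + om *~ (s1 ^+ 2)).
have rO : r \in O by rewrite /r; in_subring.
exists (r + b); first by apply/algintP; rewrite rpredD// OA.
rewrite mulrnDl; congr (_ + _); rewrite oE /r.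
have -> : (de * w + t *+ 3) * (o - (s0%:~R + s1%:~R)) * (o - (s0%:~R - s1%:~R)) =
    w * (de * o - de * (s0%:~R + s1%:~R)) * (o - (s0%:~R - s1%:~R)) +
    t *+ 3 * (o - (s0%:~R + s1%:~R)) * (o - (s0%:~R - s1%:~R)) by ring.
rewrite zE.
have -> : w * (de * (s0%:~R + th *~ s1) + z *+ 3 - de * (s0%:~R + s1%:~R)) *
  (o - (s0%:~R - s1%:~R)) = w * ((th - 1) * (de * o - de * (s0%:~R - s1%:~R)) *~ s1
   + z * (o - (s0%:~R - s1%:~R)) *+ 3) by ring.
by rewrite zE omE deE; field.
Qed.

(* [O / J] has four residue fields F_3, given by [om] in {0, -1} and [th] in
   {1, -1}.  The values of [eta] there are 1, -1, 0, 1, hence the generator [u]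
   below, and [f] is supported at the point [om = 0, th = -1].  The term
   [de * (th - g)] in [eta] is tuned so that [eta ^+ 3 - eta = de] modulo 3. *)
Let om2 : om ^+ 2 = - om + (de * (1 - g) + (g + om) *+ 3).
Proof. by rewrite gE omE deE; field. Qed.

Let eta := th + om + de * (th - g).
Let f := (1 - th) * (1 + om).
Let v := - g - om + om * (th - g).
(** On [de O] modulo 3, [eta] acts as [th - 1], with values 0 and 1 modulo 3 at the two ramified
    points. The factors [eta] and [eta - 1] therefore kill [de], which makes the quotient by 3
    integral. *)
Let u := (eta ^+ 3 - eta) * (eta * (eta - 1)) / 3%:R.

Let etaO : eta \in O.
Proof. rewrite /eta; in_subring. Qed.

Let vO : v \in O.
Proof. rewrite /v; in_subring. Qed.

Let fO : f \in O.
Proof. rewrite /f; in_subring. Qed.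

Let u3 : u *+ 3 = (eta ^+ 3 - eta) * (eta * (eta - 1)).
Proof. by rewrite /u; field. Qed.

Let de_eta : de * eta = de * (th - 1) + v *+ 3.
Proof. by rewrite /eta /v gE omE deE; field. Qed.

Let eta3E : exists2 w, w \in O & eta ^+ 3 - eta = de + w *+ 3.
Proof.
exists (th ^+ 2 * om + th * om ^+ 2 + (th + om) ^+ 2 * de * (th - g)
  + (th + om) * de ^+ 2 * (th - g) ^+ 2 + om * de * (th - g) ^+ 3
  + g + g ^+ 2 + om * g *+ 2); first in_subring.
by rewrite /eta gE omE deE; field.
Qed.

Let eta2E : exists2 j, j \in J & eta ^+ 2 - eta = f + j.
Proof.
exists (de * (2%:R - g + (th + om) * (th - g) *+ 2 - (th - g))
        + (g + th * om + om * (th - g) ^+ 2) *+ 3).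
  by apply: rpredD; [apply: ideal_gen; in_subring | apply: ideal_mulrn; in_subring].
by rewrite /eta /f gE omE deE; field.
Qed.

(** The quotient [w] of [eta3E] can stay abstract: modulo [J] it enters only as a multiple of [f],
    and [f_eigen] turns such multiples into integer multiples of [f]. *)
Let uE : exists w j, [/\ w \in O, j \in J & u = om * th + f * (g *+ 2 + w) + j].
Proof.
have [w wO wE] := eta3E; have [j jJ jE] := eta2E.
exists w, (w * j
  + de * (1 - th - g * (1 - g) + om *+ 2 - (1 - g) * (1 - th) + (th - g) * v)
  + (om * (1 - th) *+ 2 - g * (g + om) - (g + om) * (1 - th)) *+ 3).
split=> //.
  apply: rpredD; last by apply: ideal_mulrn; in_subring.
  by apply: rpredD; [exact: idealMl | apply: ideal_gen; in_subring].
have -> : u = om + de * (1 - th) + v * (th + eta - 2%:R) + w * (eta ^+ 2 - eta).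
  apply: (natmul_inj (isT : (0 < 3)%N)) => /=; rewrite u3 wE.
  have -> : (de + w *+ 3) * (eta * (eta - 1)) =
      de * eta * (eta - 1) + w * (eta ^+ 2 - eta) *+ 3 by ring.
  rewrite de_eta.
  have -> : (de * (th - 1) + v *+ 3) * (eta - 1) =
      (de * eta - de) * (th - 1) + v * (eta - 1) *+ 3 by ring.
  by rewrite de_eta omE deE; field.
by rewrite jE /f /v /eta gE omE deE; field.
Qed.

(** At the one point supporting [f], the residue field is F_3, with [th] acting as -1 and [om] as
    0. *)
Let f_eigen y : y \in O -> exists (n : int), exists2 j, j \in J & f * y = f *~ n + j.
Proof.
pose W : {pred K} := fun x => `[< exists (n : int), exists2 j, j \in J &
    f * x = f *~ n + j >].
suff OW : {subset O <= W} by move=> /OW/asboolP.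
apply: subring2_ind.
- split=> [|x t /asboolP[n [j jJ xE]] /asboolP[m [k kJ tE]]]; apply/asboolP.
    by exists 0, 0; [exact: rpred0 | ring].
  by exists (n - m), (j - k); [exact: rpredB | rewrite mulrBr xE tE; ring].
- by apply/asboolP; exists 1, 0; [exact: rpred0 | ring].
- move=> x /asboolP[n [j jJ xE]]; apply/asboolP.
  exists (- n), (de * (- (1 + om) *~ n) + th * j).
    by apply: rpredD; [apply: ideal_gen; in_subring | exact: idealMl].
  by rewrite mulrCA xE /f deE; ring.
- move=> x /asboolP[n [j jJ xE]]; apply/asboolP.
  exists 0, (de * ((1 - g) * (1 - th) *~ n) + ((g + om) * (1 - th) *~ n) *+ 3 + om * j).
    apply: rpredD; last exact: idealMl.
    by apply: rpredD; [apply: ideal_gen; in_subring | apply: ideal_mulrn; in_subring].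
  by rewrite mulrCA xE /f gE omE deE; field.
Qed.

Let w1 (i : 'I_1) := u.
Local Notation M := (span_mod eta w1 3).

Let OM : {subset O <= M}.
Proof.
have M3 z : z \in O -> z *+ 3 \in M by move=> /OA; exact: span_mod_mulrn.
have MB b : b \in zadjoin eta -> b \in M by exact: span_mod_zadjoin.
have etaB := zadjoin_gen eta.
have powB n : eta ^+ n - eta \in zadjoin eta by apply: rpredB => //; exact: rpredX.
have M1 : 1 \in M by apply: MB; exact: rpred1.
have Mu : u \in M by exact: (span_mod_gen eta w1 3 ord0).
have [w wO wE] := eta3E.
have Mde : de \in M.
  have -> : de = (eta ^+ 3 - eta) - w *+ 3 by rewrite wE; ring.
  by apply: rpredB; [exact/MB/powB | exact: M3].
have Mdeth : de * th \in M.
  have -> : de * th = eta * (eta ^+ 3 - eta) + de - (eta * w + v) *+ 3.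
    by rewrite wE mulrDr [eta * de]mulrC de_eta; ring.
  apply: rpredB; last by apply: M3; in_subring.
  by apply: rpredD => //; apply: MB; apply: rpredM => //; exact: powB.
have JM : {subset J <= M}.
  move=> _ /idealP[y [z [yO zO ->]]]; have [s0 [s1 [t tO ->]]] := de_eigen yO.
  have -> : de * (s0%:~R + th *~ s1) + t *+ 3 + z *+ 3 =
    de *~ s0 + (de * th) *~ s1 + (t + z) *+ 3 by ring.
  apply: rpredD; last by apply: M3; in_subring.
  by rewrite rpredD ?rpredMz.
have Mf : f \in M.
  have [j jJ jE] := eta2E; have -> : f = (eta ^+ 2 - eta) - j by rewrite jE addrK.
  by apply: rpredB; [exact/MB/powB | exact: JM].
have Mfy y : y \in O -> f * y \in M.
  by move=> /f_eigen[n [j jJ ->]]; rewrite rpredD ?rpredMz// JM.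
have Momth : om * th \in M.
  have [w' [j [w'O jJ uE']]] := uE.
  have -> : om * th = u - f * (g *+ 2 + w') - j by rewrite uE'; ring.
  by apply: rpredB; [apply: rpredB => //; apply: Mfy; in_subring | exact: JM].
have Mthom : th + om \in M.
  have -> : th + om = eta - de * (th - g) by rewrite /eta; ring.
  by apply: rpredB; [exact: MB | apply/JM/ideal_gen; in_subring].
have Mom : om \in M.
  (* As [f = 1 - th + om - om * th], the parenthesis equals [2 om], and 2 is invertible modulo 3. *)
  have -> : om = om *+ 3 - (f - 1 + (th + om) + om * th) by rewrite /f; ring.
  apply: rpredB; first exact: M3.
  by apply: rpredD => //; apply: rpredD => //; exact: rpredB.
have Mth : th \in M by rewrite -(addrK om th) rpredB.
pose W : {pred K} := fun x => `[< exists n0 n1 n2 n3 : int, exists2 j, j \in J &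
  x = n0%:~R + th *~ n1 + om *~ n2 + (om * th) *~ n3 + j >].
have WM : {subset W <= M}.
  move=> x /asboolP[n0 [n1 [n2 [n3 [j jJ ->]]]]].
  by apply: rpredD; [rewrite !rpredD ?rpredMz | exact: JM].
move=> x xO; apply: WM; apply: subring2_ind xO.
- split=> [|_ _ /asboolP[n0 [n1 [n2 [n3 [j jJ ->]]]]]
             /asboolP[m0 [m1 [m2 [m3 [k kJ ->]]]]]]; apply/asboolP.
    by exists 0, 0, 0, 0, 0; [exact: rpred0 | ring].
  exists (n0 - m0), (n1 - m1), (n2 - m2), (n3 - m3), (j - k); first exact: rpredB.
  by ring.
- by apply/asboolP; exists 1, 0, 0, 0, 0; [exact: rpred0 | ring].
- move=> _ /asboolP[n0 [n1 [n2 [n3 [j jJ ->]]]]]; apply/asboolP.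
  exists n1, n0, n3, n2, (de * (n1%:~R + om *~ n3) + th * j).
    by apply: rpredD; [apply: ideal_gen; in_subring | exact: idealMl].
  by rewrite deE; ring.
- move=> _ /asboolP[n0 [n1 [n2 [n3 [j jJ ->]]]]]; apply/asboolP.
  exists 0, 0, (n0 - n2), (n1 - n3),
    (de * ((1 - g) * (n2%:~R + th *~ n3)) + ((g + om) * (n2%:~R + th *~ n3)) *+ 3
     + om * j).
    apply: rpredD; last exact: idealMl.
    by apply: rpredD; [apply: ideal_gen; in_subring | apply: ideal_mulrn; in_subring].
  have -> : om * (n0%:~R + th *~ n1 + om *~ n2 + om * th *~ n3 + j) =
    om *~ n0 + (om * th) *~ n1 + om ^+ 2 * (n2%:~R + th *~ n3) + om * j by ring.
  by rewrite om2; ring.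
Qed.

Lemma index3_witness : \dim {:K} = 6%N -> exists eta,
  [/\ eta \in algint K, <<1; eta>>%VS = fullv :> {vspace K} &
      ~~ (3 ^ 2 %| subgroup_index (@ring_of_integers K) (Zadjoin eta))%N].
Proof.
move=> dimK; exists eta; have etaA := OA etaO.
have etaB := zadjoin_gen eta.
have uA : u \in algint K.
  have [w [j [wO /idealP[y [z [yO zO ->]]] ->]]] := uE; apply: OA; in_subring.
have [] := @index_zadjoin_upper K th thA gen 3 1 eta w1 isT; rewrite ?dimK//.
- move=> i; rewrite /w1 u3 rpredM//; first by apply: rpredB => //; exact: rpredX.
  by apply: rpredM => //; apply: rpredB => //; exact: rpred1.
- move=> x /span3[o [a [oO aA ->]]].
  by apply: rpredD; [exact: OM | exact: span_mod_mulrn].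
Qed.

End Three.

(** * The trinomial *)

Lemma quadratic_algint (K : fieldExtType rat) (x p q : K) :
  p \in algint K -> q \in algint K -> x ^+ 2 + p * x + q = 0 -> x \in algint K.
Proof.
move=> pA qA xE.
have sz : (size (p *: 'X + q%:P : {poly K})%R < 3)%N.
  rewrite (leq_ltn_trans (size_polyD _ _))// gtn_max.
  rewrite (leq_ltn_trans (size_scale_leq _ _)) ?size_polyX//.
  by rewrite (leq_ltn_trans (size_polyC_leq1 _)).
apply: (@algint_root _ ('X^2 + (p *: 'X + q%:P))).
- by rewrite monicE lead_coefDl ?lead_coefXn// size_polyXn.
- rewrite rpredD ?rpredX ?polyOverX// rpredD ?polyOverC//.
  by rewrite -mul_polyC rpredM ?polyOverC ?polyOverX.
- by rewrite /root !hornerD hornerXn hornerZ hornerX hornerC addrA xE.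
Qed.

Lemma field_indexP (K : fieldExtType rat) p k :
  (forall eta, eta \in algint K ->
    (p ^ k %| subgroup_index (@ring_of_integers K) (Zadjoin eta))%N) ->
  (exists eta, [/\ eta \in algint K, <<1; eta>>%VS = fullv :> {vspace K} &
    ~~ (p ^ k.+1 %| subgroup_index (@ring_of_integers K) (Zadjoin eta))%N]) ->
  (p ^ k %| field_index K)%N /\ ~~ (p ^ k.+1 %| field_index K)%N.
Proof.
move=> low [eta [etaA gen up]].
have [dvd max] := set_gcdP [set subgroup_index (@ring_of_integers K) (Zadjoin eta) |
  eta in [set eta | ring_of_integers eta /\ <<1; eta>>%VS = fullv]].
split; first by apply: max => _ [x [/algintP xA _] <-]; apply: low.
apply: contra up => /dvdn_trans; apply; apply: dvd.
by exists eta => //; split=> //; apply/algintP.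
Qed.

Lemma subgroup_index_refl (V : zmodType) (G : set V) :
  subgroup G -> subgroup_index G G = 1%N.
Proof.
move=> sG; rewrite (transversal_index (T := unit) (r := fun=> 0) sG _).2.
  by rewrite card_unit.
split=> [_|x Gx|[] []//]; first exact: subgroup0.
by exists tt; rewrite subr0.
Qed.

Lemma not_monogenic (K : fieldExtType rat) p k : prime p -> (0 < k)%N ->
  (forall eta, eta \in algint K ->
    (p ^ k %| subgroup_index (@ring_of_integers K) (Zadjoin eta))%N) ->
  ~ monogenic K.
Proof.
move=> pp k0 low [eta /algintP etaA AE]; have := low eta etaA.
rewrite -AE subgroup_index_refl; last exact: subgroup_algint.
by rewrite dvdn1 -(expn0 p) eqn_exp2l ?prime_gt1//; case: k k0 {low}.
Qed.

Section Trinomial.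
Variables (m : nat) (a b : int) (K : fieldExtType rat) (theta : K).
Hypothesis m_le5 : (m <= 5)%N.
Hypothesis hirr : irreducible_poly (sextic_trinomial m a b).
Hypothesis hroot : root (map_poly (in_alg K) (sextic_trinomial m a b)) theta.
Hypothesis hK : <<1; theta>>%VS = fullv :> {vspace K}.

Lemma trinomial_eq0 : theta ^+ 6 + theta ^+ m *~ a + b%:~R = 0.
Proof.
have /eqP <- := hroot; rewrite /sextic_trinomial !rmorphD /= map_polyXn.
rewrite map_polyZ map_polyXn map_polyC !hornerD hornerZ !hornerXn hornerC.
have intE (n : int) : in_alg K n%:~R = n%:~R by exact: rmorph_int.
by rewrite -[theta ^+ m *~ a]mulrzl -!intE.
Qed.

Lemma size_trinomial : size (sextic_trinomial m a b) = 7.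
Proof.
rewrite /sextic_trinomial -addrA size_polyDl size_polyXn//.
rewrite (leq_ltn_trans (size_polyD _ _))// gtn_max.
rewrite (leq_ltn_trans (size_scale_leq _ _)) ?size_polyXn//=.
by rewrite (leq_ltn_trans (size_polyC_leq1 _)).
Qed.

Lemma dim_trinomial : \dim {:K} = 6%N.
Proof.
rewrite -hK dim_Fadjoin dimv1 muln1; apply: succn_inj; rewrite -size_minPoly.
have /polyOver1P[f fE] := minPolyOver 1 theta.
rewrite fE size_map_poly; apply: etrans _ size_trinomial; apply: eqp_size.
apply: hirr.2.
  rewrite -(size_map_poly (in_alg K)) -fE size_minPoly eqSS -lt0n.
  by rewrite adjoin_degreeE divn_gt0 ?adim_gt0// dimvS ?subv_adjoin.
rewrite -(dvdp_map (in_alg K)) -fE; apply: minPoly_dvdp => //.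
by apply/polyOver1P; exists (sextic_trinomial m a b).
Qed.

Lemma theta_algint : theta \in algint K.
Proof.
have intA (n : int) : n%:~R \in algint K by exact: rpred_int.
apply: (@algint_root _ ('X^6 + ((a%:~R)%:P * 'X^m + (b%:~R)%:P))).
- rewrite monicE lead_coefDl ?lead_coefXn// size_polyXn mul_polyC.
  rewrite (leq_ltn_trans (size_polyD _ _))// gtn_max.
  rewrite (leq_ltn_trans (size_scale_leq _ _)) ?size_polyXn//=.
  by rewrite (leq_ltn_trans (size_polyC_leq1 _)).
- by rewrite !(rpredD, rpredM, rpredX, polyOverX, polyOverC).
- rewrite /root !hornerD hornerXn hornerM hornerXn !hornerC addrA mulrzl.
  exact/eqP/trinomial_eq0.
Qed.

Lemma trinomial_index2 : (a = 0 %[mod 8])%Z /\ (b = -1 %[mod 8])%Z ->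
  (forall eta, eta \in algint K ->
    (2 ^ 2 %| subgroup_index (@ring_of_integers K) (Zadjoin eta))%N) /\
  (exists eta, [/\ eta \in algint K, <<1; eta>>%VS = fullv :> {vspace K} &
    ~~ (2 ^ 3 %| subgroup_index (@ring_of_integers K) (Zadjoin eta))%N]).
Proof.
move=> [/eqP a8 /eqP b8].
have [a' aE] : exists a', a = a' * 8 by apply/dvdzP; rewrite -[a]subr0 -eqz_mod_dvd.
have [b' bE] : exists b', b + 1 = b' * 8.
  by apply/dvdzP; rewrite -[1]opprK -eqz_mod_dvd.
(* The congruences say [theta ^+ 6 = 1 - 8 g]. With [theta ^+ 3 = 1 + 2 om] this reads
   [om ^+ 2 + om = - 2 g]; the modulus 8 is what makes the right side even, so that [om] is
   idempotent modulo 2. *)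
pose g := b'%:~R + theta ^+ m *~ a'; pose om := (theta ^+ 3 - 1) / 2%:R.
have two0 : 2%:R != 0 :> K by exact: natr_neq0.
have gZ : g \in zadjoin theta.
  by rewrite rpredD ?rpred_int// rpredMz// rpredX// zadjoin_gen.
have th3 : theta ^+ 3 = 1 + om *+ 2 by rewrite /om; field.
have om2 : om ^+ 2 = - om - g *+ 2.
  have th6 : theta ^+ 6 = 1 - g *+ 8.
    apply/eqP; rewrite -subr_eq0 -[X in _ == X]trinomial_eq0 aE.
    by rewrite (_ : b = b' * 8 - 1) /g; [apply/eqP; ring | rewrite -bE addrK].
  have four0 : 4%:R != 0 :> K by exact: natr_neq0.
  have -> : om ^+ 2 = (theta ^+ 6 - theta ^+ 3 *+ 2 + 1) / 4%:R.
    by rewrite /om; field; rewrite four0 two0.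
  by rewrite th6 /om; field; rewrite four0 two0.
have thA := theta_algint.
have omA : om \in algint K.
  apply: (@quadratic_algint _ _ 1 (g *+ 2)); rewrite ?rpred1//.
    by apply: rpredMn; exact: (zadjoin_sub thA gZ).
  by rewrite om2; ring.
split=> [eta etaA|].
  exact: (dvdn_index2 thA omA gZ th3 om2 hK etaA dim_trinomial).
exact: (index2_witness thA omA gZ th3 om2 hK dim_trinomial).
Qed.

Lemma trinomial_index3 : (a = 0 %[mod 9])%Z /\ (b = -1 %[mod 9])%Z ->
  (forall eta, eta \in algint K ->
    (3 ^ 1 %| subgroup_index (@ring_of_integers K) (Zadjoin eta))%N) /\
  (exists eta, [/\ eta \in algint K, <<1; eta>>%VS = fullv :> {vspace K} &
    ~~ (3 ^ 2 %| subgroup_index (@ring_of_integers K) (Zadjoin eta))%N]).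
Proof.
move=> [/eqP a9 /eqP b9].
have [a' aE] : exists a', a = a' * 9 by apply/dvdzP; rewrite -[a]subr0 -eqz_mod_dvd.
have [b' bE] : exists b', b + 1 = b' * 9.
  by apply/dvdzP; rewrite -[1]opprK -eqz_mod_dvd.
pose g := b'%:~R + theta ^+ m *~ a'; pose de := theta ^+ 2 - 1.
pose om := de ^+ 2 / 3%:R.
have three0 : 3%:R != 0 :> K by exact: natr_neq0.
have gZ : g \in zadjoin theta.
  by rewrite rpredD ?rpred_int// rpredMz// rpredX// zadjoin_gen.
have th2 : theta ^+ 2 = 1 + de by rewrite /de; ring.
have de2 : de ^+ 2 = om *+ 3 by rewrite /om; field.
have th6 : theta ^+ 6 = 1 - g *+ 9.
  apply/eqP; rewrite -subr_eq0 -[X in _ == X]trinomial_eq0 aE.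
  by rewrite (_ : b = b' * 9 - 1) /g; [apply/eqP; ring | rewrite -bE addrK].
(* Expand [(1 + de) ^+ 3 = 1 - 9 g] using [de ^+ 2 = 3 om], and divide by 3. *)
have deom : de * om = - (g *+ 3) - de - om *+ 3.
  have nine0 : 9%:R != 0 :> K by exact: natr_neq0.
  have -> : g = (1 - theta ^+ 6) / 9%:R by rewrite th6; field.
  by rewrite /om /de; field; rewrite nine0 three0.
have thA := theta_algint.
have gA : g \in algint K := zadjoin_sub thA gZ.
have deA : de \in algint K by rewrite rpredB ?rpredX ?rpred1.
(* Multiplying [deom] by [de / 3] gives [om ^+ 2 + (1 + de) * om + de * g = 0], with integral
   coefficients. *)
have omA : om \in algint K.
  apply: (@quadratic_algint _ _ (1 + de) (de * g)).
  - by rewrite rpredD ?rpred1.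
  - by rewrite rpredM.
  - have -> : g = - (de * om + de + om *+ 3) / 3%:R by rewrite deom; field.
    by rewrite /om; field.
split=> [eta etaA|].
  exact: (dvdn_index3 thA omA gZ th2 de2 deom hK etaA dim_trinomial).
exact: (index3_witness thA omA gZ th2 de2 deom hK dim_trinomial).
Qed.

End Trinomial.

Theorem theorem2p5 (m : nat) (a b : int) (K : fieldExtType rat) (theta : K)
    (hm : (1 <= m <= 5)%N)
    (hirr : irreducible_poly (sextic_trinomial m a b))
    (hroot : root (map_poly (in_alg K) (sextic_trinomial m a b)) theta)
    (hK : <<1; theta>>%VS = fullv) :
  [/\ (a = 0 %[mod 9])%Z /\ (b = -1 %[mod 9])%Z ->
        (field_index K = 3 %[mod 9])%N \/ (field_index K = 6 %[mod 9])%N,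
      (a = 0 %[mod 8])%Z /\ (b = -1 %[mod 8])%Z ->
        (field_index K = 4 %[mod 8])%N
    & ((a = 0 %[mod 9])%Z /\ (b = -1 %[mod 9])%Z) \/
      ((a = 0 %[mod 8])%Z /\ (b = -1 %[mod 8])%Z) ->
        ~ monogenic K].
Proof.
have /andP[_ m5] := hm.
split=> [h3|h2|[h3|h2]].
- have [low up] := trinomial_index3 m5 hirr hroot hK h3.
  (* Exact divisibility by 3 leaves the cofactor free among the units modulo 3, hence two classes
     modulo 9; for exact divisibility by 4 the cofactor is odd, hence one class modulo 8. *)
  by have [] := field_indexP low up; lia.
- have [low up] := trinomial_index2 m5 hirr hroot hK h2.
  by have [] := field_indexP low up; lia.
- have [low _] := trinomial_index3 m5 hirr hroot hK h3.
  exact: not_monogenic low.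
- have [low _] := trinomial_index2 m5 hirr hroot hK h2.
  exact: not_monogenic low.
Qed.
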